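(* Let $X$ be a uniformly smooth Banach space and let $\Omega\subset X$ be a convex domain. Then for every $x_0\in\Omega$ the function $k(x_0,\cdot)\colon \Omega\to[0,\infty)$, where $k=k_\Omega$ is the quasihyperbolic metric of $\Omega$, is continuously Fréchet differentiable on $\Omega\setminus\{x_0\}$.
   Context: Banach spaces are real. A domain $\Omega\subset X$ is an open path-connected subset with non-empty boundary $\partial\Omega$. Write $d(z,\partial\Omega)=\inf\{\|z-w\|: w\in\partial\Omega\}$. The quasihyperbolic metric on $\Omega$ is $$k_\Omega(x,y)=\inf_\gamma\int_\gamma\frac{\|dz\|}{d(z,\partial\Omega)},$$ the infimum being over all rectifiable curves $\gamma$ in $\Omega$ joining $x$ and $y$. $X$ is uniformly smooth if $\lim_{\tau\to0^+}\mu(\tau)/\tau=0$, where $\mu(\tau)=\sup\{(\|y+h\|+\|y-h\|)/2-1 : y,h\in X,\ \|y\|=1,\ \|h\|=\tau\}$. *)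

(* Defs.v *)
From HB Require Import structures.
From mathcomp Require Import all_boot all_order all_algebra.
From mathcomp Require Import all_classical all_reals all_analysis.

Set Implicit Arguments.
Unset Strict Implicit.
Unset Printing Implicit Defensive.

Import Order.TTheory GRing.Theory Num.Theory.
Import numFieldNormedType.Exports.

Local Open Scope classical_set_scope.
Local Open Scope ring_scope.

Section smoothness.
Context {R : realType} (X : normedModType R).

Definition smoothness_modulus (tau : R) : R :=
  sup [set r : R | exists y h : X, [/\ `|y| = 1, `|h| = tau &
                     r = (`|y + h| + `|y - h|) / 2 - 1]].

Definition uniformly_smooth : Prop :=
  smoothness_modulus tau / tau @[tau --> 0^'+] --> (0 : R).

End smoothness.

Section quasihyperbolic.
Context {R : realType} {X : normedModType R}.
Implicit Types (A Omega : set X) (x y z : X) (g : R -> X) (rho : X -> R).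

Definition boundary A : set X := closure A `\` A°.

(* Curves are parametrised by [0, 1]; values outside [0, 1] are irrelevant. *)
Definition is_curve A x y g : Prop :=
  [/\ {within `[0, 1], continuous g}, (forall t : R, t \in `[0, 1] -> A (g t)),
      g 0 = x & g 1 = y].

Definition path_connected A : Prop :=
  forall x y, A x -> A y -> exists g, is_curve A x y g.

Definition domain Omega : Prop :=
  [/\ open Omega, path_connected Omega & boundary Omega !=set0].

(* As in [itv_partition] and [variation], a subdivision of [0, 1] is a list s
   such that 0 :: s is increasing and ends at 1; [node s n] is its n-th point. *)
Definition node (s : seq R) (n : nat) : R := nth 1 (0 :: s) n.

Definition polygonal_length g (s : seq R) : R :=
  \sum_(0 <= n < size s) `|g (node s n.+1) - g (node s n)|.

Definition rectifiable g : Prop :=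
  has_ubound [set polygonal_length g s | s in itv_partition 0 1].

(* [is_line_integral rho g I] : the integral of rho(z) ||dz|| along g exists and
   equals I, as the limit when the mesh tends to 0 of the Riemann-Stieltjes sums
   sum_n rho(g(xi_n)) ||g(t_(n+1)) - g(t_n)|| with t_n <= xi_n <= t_(n+1). *)
Definition is_line_integral rho g (I : R) : Prop :=
  forall e : R, 0 < e -> exists2 delta : R, 0 < delta &
    forall (s : seq R) (xi : nat -> R), itv_partition 0 1 s ->
      (forall n, (n < size s)%N ->
         node s n <= xi n <= node s n.+1 /\ node s n.+1 - node s n < delta) ->
      `|\sum_(0 <= n < size s)
          rho (g (xi n)) * `|g (node s n.+1) - g (node s n)| - I| < e.

Definition set_dist z A : R := inf [set `|z - w| | w in A].

(* The integrand is continuous on Omega, so the integral exists along every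
   rectifiable curve in Omega. *)
Definition quasihyperbolic Omega x y : R :=
  inf [set I : R | exists g, [/\ is_curve Omega x y g, rectifiable g &
         is_line_integral (fun z => (set_dist z (boundary Omega))^-1) g I]].

End quasihyperbolic.

Section continuous_differentiability.
Context {R : realType} {X : normedModType R}.

Definition operator_norm (l : X -> R) : R :=
  sup [set `|l h| | h in [set h : X | `|h| <= 1]].

(* U is meant to be open. *)
Definition continuously_differentiable_on (U : set X) (f : X -> R) : Prop :=
  (forall x, U x -> differentiable f x) /\
  (forall x, U x ->
     operator_norm (fun h => 'd f y h - 'd f x h) @[y --> within U (nbhs x)]
       --> (0 : R)).

End continuous_differentiability.

(* Main.v *)
From HB Require Import structures.
Require Import Defs.
From mathcomp Require Import all_boot all_order all_algebra.
From mathcomp Require Import all_classical all_reals all_analysis.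
From mathcomp Require Import ring lra.
Set Implicit Arguments.
Unset Strict Implicit.
Unset Printing Implicit Defensive.
Import Order.TTheory GRing.Theory Num.Theory.
Import numFieldNormedType.Exports.

Local Open Scope classical_set_scope.
Local Open Scope ring_scope.

(** Write k for the quasihyperbolic metric of Omega, d for the distance to the
    boundary and f for the function k x0. Convexity of Omega makes d concave
    ([bdist_concave]), and near every point of Omega other than x0 this yields
    - a Lipschitz bound for f;
    - semiconvexity: f (l a + (1 - l) b) <= l f a + (1 - l) f b + C |a - b|^2
      ([qh_semiconvex]);
    - smoothness from above: f (y + h) + f (y - h) - 2 f y <= e |h| for all
      small h, uniformly in y ([qh_second_difference]).
    These estimates alone give continuous differentiability ([C1_at]).
    Semiconvexity makes the difference quotients of f along a ray almost
    monotone in the step, and smoothness together with semiconvexity squeezes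
    the sum of the quotients in the directions h and - h to 0; hence the
    quotients converge uniformly, to a limit that is both convex and odd in h,
    and so linear.

    Nearly minimal broken lines take the place of geodesics. Let the edge from p
    to q cost |p - q| / min (d p, d q). The cost of an inscribed broken line is
    one of the Riemann-Stieltjes sums defining the integral along a curve, and,
    d being concave, it bounds the integral along the broken line from above. So
    k is the infimum of the costs of broken lines ([qh_chain], [qh_le_chain]).

    For semiconvexity, two broken lines that start at x0 and take the same time
    are averaged edge by edge: the speed ratio (|p'| + |q'|) / (d p + d q) of
    the average is at most the larger of the two ratios, so f is quasiconvex
    ([qh_quasiconvex]). If f a > f b, a nearly minimal line to a is cut at a
    point z with f z <= f b, which lies at distance about d a (f a - f b) from
    a. Quasiconvexity for z and b, followed by a short move of cost about
    l (f a - f b), reaches l a + (1 - l) b.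

    For smoothness, a nearly minimal line to y is cut at a point z with
    |z - y| = |h| / tau, and its end is replaced by the segments from z to
    y + h and to y - h. Treating d as constant on such a short scale costs
    O(|h|^2), and uniform smoothness of the norm bounds
    |z - y - h| + |z - y + h| - 2 |z - y|. *)

(** * Distance to the boundary of a convex domain *)

Notation bdist Omega z := (set_dist z (boundary Omega)).

Section BoundaryDistance.
Variables (R : realType) (X : normedModType R) (Omega : set X).
Hypotheses (openO : open Omega) (bdO : boundary Omega !=set0).
Hypothesis convO : forall a b (l : R), Omega a -> Omega b -> 0 <= l <= 1 ->
  Omega (l *: a + (1 - l) *: b).

Local Notation d z := (bdist Omega z).

Lemma has_lbound_dist (z : X) (A : set X) : has_lbound [set `|z - w| | w in A].
Proof. by exists 0 => _ [w _ <-]. Qed.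

Lemma set_dist_le (z w : X) (A : set X) : A w -> set_dist z A <= `|z - w|.
Proof. by move=> Aw; apply: ge_inf; [exact: has_lbound_dist | exists w]. Qed.

Lemma le_set_dist (z : X) (A : set X) (r : R) : A !=set0 ->
  (forall w, A w -> r <= `|z - w|) -> r <= set_dist z A.
Proof.
move=> [w0 Aw0] H; apply: lb_le_inf; first by exists `|z - w0|, w0.
by move=> _ [w Aw <-]; exact: H.
Qed.

Lemma set_dist_lipschitz (A : set X) (z z' : X) : A !=set0 ->
  set_dist z A - `|z - z'| <= set_dist z' A.
Proof.
move=> A0; apply: le_set_dist => // w Aw; rewrite lerBlDr.
apply: (le_trans (set_dist_le _ Aw)); rewrite [leRHS]addrC.
by have := ler_normD (z - z') (z' - w); rewrite addrA subrK.
Qed.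

Lemma boundary_notin w : boundary Omega w -> ~ Omega w.
Proof. by move=> [_ nw] Ow; apply: nw; apply: open_nbhs_nbhs. Qed.

Lemma bdist_gt0 z : Omega z -> 0 < d z.
Proof.
move=> Oz; have /nbhs_ballP[e /= e0 eO] : nbhs z Omega by exact: open_nbhs_nbhs.
apply: (lt_le_trans e0); apply: le_set_dist => // w bw; rewrite leNgt; apply/negP.
by move=> zw; apply: (boundary_notin bw); apply: eO; rewrite -ball_normE.
Qed.

(** The segment from a to p misses the boundary, so Omega is relatively open and
    closed in it. *)
Lemma ball_bdist_sub a p : Omega a -> `|a - p| < d a -> Omega p.
Proof.
move=> Oa pa.
pose f (s : R) := a + s *: (p - a).
have cf : {within `[0 : R, 1], continuous f}.
  apply: continuous_subspaceT => s; apply: cvgD; first exact: cvg_cst.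
  by apply: cvgZr_tmp.
pose B := (f @` `[0 : R, 1]) `&` Omega.
have conn := connected_continuous_connected (@segment_connected R 0 1) cf.
have f0 : f 0 = a by rewrite /f scale0r addr0.
have f1 : f 1 = p by rewrite /f scale1r addrC subrK.
have H : B = f @` `[0 : R, 1].
  apply: conn; first by exists a; split => //; exists 0 => //=; rewrite in_itv/= lexx ler01.
    by exists Omega.
  exists (closure Omega); first exact: closed_closure.
  apply/seteqP; split => x [fx Ox]; split => //; first exact: subset_closure.
  apply: contrapT => nOx.
  have bx : boundary Omega x.
    by split => // /interior_subset.
  have := set_dist_le a bx; apply/negP; rewrite -ltNge.
  apply: le_lt_trans pa; case: fx => s /=; rewrite in_itv/= => /andP[s0 s1] <-.
  rewrite /f opprD addrA subrr sub0r normrN normrZ ger0_norm//.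
  by rewrite -[leRHS]mul1r distrC ler_wpM2r.
have : B p by rewrite H; exists 1 => //=; rewrite in_itv/= lexx ler01.
by case.
Qed.

(** The convex hull of the balls of radius d a around a and d b around b lies in
    Omega and contains the ball of the averaged radius around the average. *)
Lemma bdist_concave a b (l : R) : Omega a -> Omega b -> 0 <= l <= 1 ->
  l * d a + (1 - l) * d b <= d (l *: a + (1 - l) *: b).
Proof.
move=> Oa Ob /andP[l0 l1]; set c := l *: a + _; set r := _ + _.
have da := bdist_gt0 Oa; have db := bdist_gt0 Ob.
have r0 : 0 < r.
  by rewrite /r; nra.
apply: le_set_dist => // w bw; rewrite leNgt; apply/negP => cw.
apply: (boundary_notin bw).
pose v := w - c; have vr : `|v| < r by rewrite distrC.
have cv : c + v = w by rewrite addrC subrK.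
clearbody v.
have Oin q : Omega q -> Omega (q + (d q / r) *: v).
  move=> Oq; have dq := bdist_gt0 Oq; apply: (ball_bdist_sub Oq).
  rewrite opprD addrA subrr sub0r normrN normrZ ger0_norm; last by rewrite divr_ge0 // ltW.
  by rewrite mulrAC -mulrA gtr_pMr // ltr_pdivrMr ?mul1r.
have -> : w = l *: (a + (d a / r) *: v) + (1 - l) *: (b + (d b / r) *: v).
  rewrite !scalerDr addrACA !scalerA -scalerDl !mulrA -mulrDl -/r divff ?gt_eqF// scale1r.
  by rewrite -/c cv.
by apply: convO; rewrite ?l0 //; apply: Oin.
Qed.
End BoundaryDistance.

(** * Curves with a controlled line element *)

Section Antiderivative.
Variable R : realType.

Lemma antiderivative_mean (r : R -> R) : continuous r ->
  exists Phi : R -> R, forall u w, 0 <= u -> u <= w -> w <= 1 ->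
    exists2 c, u <= c <= w & Phi w - Phi u = r c * (w - u).
Proof.
move=> cr.
pose F (x : R) : R := (\int[lebesgue_measure]_(t in [set` `[(- 1)%R, x]]) r t)%R.
have rint : lebesgue_measure.-integrable `[(- 1)%R, 2] (EFin \o r).
  apply: continuous_compact_integrable; first exact: segment_compact.
  by apply: continuous_subspaceT => x; exact: cr.
have dF (x : R) : -1 < x -> x < 2 -> is_derive x 1 F (r x).
  move=> x1 x2; have [dF1 dF2] := continuous_FTC1_closed x2 rint x1 (cr x).
  by apply: DeriveDef; [exact: dF1|rewrite -derive1E; exact: dF2].
exists F => u w u0 uw w1.
have H1 x : x \in `]u, w[%R -> is_derive x 1 F (r x).
  by rewrite in_itv/= => /andP[ux xw]; apply: dF; lra.
have H2 : {within `[u, w], continuous F}.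
  apply: derivable_within_continuous => x; rewrite in_itv/= => /andP[ux xw].
  by have [] : is_derive x 1 F (r x) by apply: dF; lra.
have [c] := MVT_segment uw H1 H2.
by rewrite in_itv/= => cuw ->; exists c.
Qed.
End Antiderivative.

Section Curves.
Variables (R : realType) (X : normedModType R) (Omega : set X).
Hypotheses (openO : open Omega) (bdO : boundary Omega !=set0).
Hypothesis convO : forall a b (l : R), Omega a -> Omega b -> 0 <= l <= 1 ->
  Omega (l *: a + (1 - l) *: b).

Local Notation d z := (bdist Omega z).

(** Zero speed at c, the error being measured against the distance to c. *)
Definition stationary_at (g : R -> X) (a b c : R) := forall e : R, 0 < e ->
  exists2 delta, 0 < delta & forall t, a <= t -> t <= b -> `|t - c| < delta ->
    `|g t - g c| <= e * `|t - c|.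

(** In the third clause V accumulates the integral of the line element, with an
    error that is small compared with the length of the parameter interval;
    summed over a partition this is convergence of the Riemann-Stieltjes sums.
    Zero speed at both ends makes the clause survive concatenation: an interval
    that straddles the joint belongs to neither piece, but contributes little. *)
Definition tame_on (g : R -> X) (V : R -> R) (a b : R) :=
  [/\ exists2 m, 0 < m & forall t, a <= t -> t <= b -> Omega (g t) /\ m <= d (g t),
      exists K, forall u w, a <= u -> u <= w -> w <= b ->
        `|g w - g u| <= K * (w - u),
      forall e, 0 < e -> exists2 delta, 0 < delta & forall u xi w,
        a <= u -> u <= xi -> xi <= w -> w <= b -> w - u < delta ->
        `|(d (g xi))^-1 * `|g w - g u| - (V w - V u)| <= e * (w - u),
      stationary_at g a b a & stationary_at g a b b].

Definition tame_curve x y (I : R) := exists (g : R -> X) (V : R -> R),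
  [/\ g 0 = x, g 1 = y, V 1 - V 0 = I & tame_on g V 0 1].

Lemma smoothstep_bound (u w : R) : 0 <= u -> u <= w -> w <= 1 ->
  0 <= w ^+ 2 * (3 - 2 * w) - u ^+ 2 * (3 - 2 * u) <= 2 * (w - u).
Proof.
move=> u0 uw w1.
have -> : w ^+ 2 * (3 - 2 * w) - u ^+ 2 * (3 - 2 * u) =
  (w - u) * (2 * (w * (1 - w)) + 2 * (u * (1 - u)) + w * (1 - u) + u * (1 - w)).
  by ring.
have A : 0 <= w * (1 - w) by apply: mulr_ge0; lra.
have B : 0 <= u * (1 - u) by apply: mulr_ge0; lra.
have C : 0 <= w * (1 - u) by apply: mulr_ge0; lra.
have D : 0 <= u * (1 - w) by apply: mulr_ge0; lra.
have E : 2 * (w * (1 - w)) + 2 * (u * (1 - u)) + w * (1 - u) + u * (1 - w) <= 2.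
  have := sqr_ge0 (w + u - 1); have := sqr_ge0 (w - u); rewrite !expr2; nra.
apply/andP; split; first by apply: mulr_ge0; lra.
by rewrite mulrC ler_wpM2r // subr_ge0.
Qed.

(** The segment is run through with the smoothstep 3 t^2 - 2 t^3, which stops at
    both ends; the integral is at most the largest weight times the length, and
    by concavity d is least at an endpoint. *)
Lemma tame_segment a b : Omega a -> Omega b ->
  exists2 I, I <= `|b - a| / Num.min (d a) (d b) & tame_curve a b I.
Proof.
move=> Oa Ob; set m := Num.min _ _.
have m0 : 0 < m by rewrite lt_min !(bdist_gt0 openO bdO).
pose seg s := a + s *: (b - a).
have segE s : seg s = s *: b + (1 - s) *: a.
  by rewrite /seg scalerBr scalerBl scale1r addrCA addrA addrC addrA.
have Oseg s : 0 <= s <= 1 -> Omega (seg s) /\ m <= d (seg s).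
  move=> s01; rewrite segE; split; first exact: convO.
  apply: le_trans (bdist_concave openO bdO convO Ob Oa s01).
  have ma : m <= d a by rewrite ge_min lexx.
  have mb : m <= d b by rewrite ge_min lexx orbT.
  by rewrite -!/(d _); nra.
pose L := `|b - a|.
have segL s t : `|seg t - seg s| = `|t - s| * L.
  by rewrite /seg opprD addrACA subrr add0r -scalerBl normrZ.
(* truncating d at m changes nothing on the segment and makes r Lipschitz on
   the whole line *)
pose r s := (Num.max m (d (seg s)))^-1.
have rL s t : `|r t - r s| <= `|t - s| * (L / m ^+ 2).
  set p := Num.max m (d (seg t)); set q := Num.max m (d (seg s)).
  have mp : m <= p by rewrite le_max lexx.
  have mq : m <= q by rewrite le_max lexx.
  have p0 : 0 < p by lra.
  have q0 : 0 < q by lra.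
  rewrite /r -/p -/q.
  have -> : p^-1 - q^-1 = (q - p) / (p * q) by field; rewrite !gt_eqF.
  rewrite normrM mulrA normfV [`|p * q|]gtr0_norm ?mulr_gt0 //.
  apply: ler_pM => //.
  - by rewrite invr_ge0 mulr_ge0 // ltW.
  - rewrite -segL; have dl z z' := set_dist_lipschitz z z' bdO.
    have H1 := dl (seg s) (seg t); have H2 := dl (seg t) (seg s).
    rewrite -!/(d _) in H1 H2; rewrite distrC in H1.
    rewrite ler_norml /p /q /Num.max.
    by case: ifP => h1; case: ifP => h2; apply/andP; split; lra.
  - by rewrite lef_pV2 ?posrE ?mulr_gt0 ?exprn_gt0 // expr2 ler_pM // ltW.
have L0 : 0 <= L by rewrite /L.
have Lm0 : 0 <= L / m ^+ 2 by apply: divr_ge0 => //; apply: exprn_ge0; exact: ltW.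
have cr : continuous r.
  move=> s; apply/cvgrPdist_lt => e e0.
  pose C := L / m ^+ 2 + 1.
  have C0 : 0 < C by rewrite /C; lra.
  apply/nbhs_ballP; exists (e / C) => /=; first by rewrite divr_gt0.
  move=> t /= st.
  apply: (le_lt_trans (rL _ _)).
  apply: (@le_lt_trans _ _ (`|s - t| * C)).
    by apply: ler_wpM2l => //; rewrite /C; lra.
  by rewrite -ltr_pdivlMr.
have [Phi PhiE] := antiderivative_mean cr.
pose phi (t : R) := t ^+ 2 * (3 - 2 * t).
have phi01 t : 0 <= t -> t <= 1 -> 0 <= phi t <= 1.
  move=> t0 t1; have := smoothstep_bound (lexx _) t0 t1.
  have := smoothstep_bound t0 t1 (lexx _).
  by rewrite /phi !expr2 => /andP[? ?] /andP[? ?]; apply/andP; split; lra.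
have p0 : phi 0 = 0 by rewrite /phi; ring.
have p1 : phi 1 = 1 by rewrite /phi; ring.
exists (L * (Phi 1 - Phi 0)).
  have [c c01 ->] := PhiE 0 1 (lexx _) ler01 (lexx _).
  rewrite subr0 mulr1; apply: ler_wpM2l => //.
  by rewrite lef_pV2 ?posrE // ?le_max ?lexx // lt_max m0.
exists (seg \o phi), (fun t => L * Phi (phi t)).
rewrite /= p0 p1 {1 2}/seg scale0r addr0 scale1r [a + _]addrC subrK mulrBr.
split=> //; split.
- by exists m => // t t0 t1; apply: Oseg; exact: phi01.
- exists (L * 2) => u w u0 uw w1 /=; have /andP[h1 h2] := smoothstep_bound u0 uw w1.
  rewrite segL mulrC -mulrA; apply: ler_wpM2l => //.
  by rewrite ger0_norm.
- move=> e e0.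
  pose C := L * 2 * (2 * (L / m ^+ 2)) + 1.
  have C0 : 0 < C by rewrite /C; nra.
  exists (e / C); first by rewrite divr_gt0.
  move=> u xi w u0 ux xw w1 wud /=.
  have uw : u <= w by lra.
  have /andP[h1 h2] := smoothstep_bound u0 uw w1.
  rewrite -/(phi _) -/(phi _) in h1 h2.
  have /andP[a1 a2] : 0 <= phi u <= 1 by apply: phi01; lra.
  have /andP[b1 b2] : 0 <= phi w <= 1 by apply: phi01; lra.
  have /andP[c1 c2] : 0 <= phi xi <= 1 by apply: phi01; lra.
  have uphi : phi u <= phi w by lra.
  have /andP[x1 x2] : 0 <= phi xi - phi u <= 2 * (xi - u) by apply: smoothstep_bound; lra.
  have /andP[y1 y2] : 0 <= phi w - phi xi <= 2 * (w - xi) by apply: smoothstep_bound; lra.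
  have [c /andP[cu cw] Pc] := PhiE _ _ a1 uphi b2.
  rewrite -mulrBr Pc segL [`|phi w - phi u|]ger0_norm //.
  have -> : (d (seg (phi xi)))^-1 = r (phi xi).
    rewrite /r; congr (_^-1); rewrite max_r //.
    by have [] := Oseg (phi xi) _; first by rewrite c1 c2.
  have -> : r (phi xi) * ((phi w - phi u) * L) - L * (r c * (phi w - phi u)) =
    (r (phi xi) - r c) * ((phi w - phi u) * L) by ring.
  rewrite normrM [`|_ * L|]ger0_norm; last by rewrite mulr_ge0.
  apply: (@le_trans _ _ ((2 * (w - u)) * (L / m ^+ 2) * ((2 * (w - u)) * L))).
    apply: ler_pM => //; first by rewrite mulr_ge0.
      apply: (le_trans (rL _ _)); apply: ler_wpM2r => //.
      by rewrite ler_norml; apply/andP; split; lra.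
    by apply: ler_wpM2r.
  have wuC : (w - u) * C <= e by rewrite ltW // -ltr_pdivlMr.
  have -> : 2 * (w - u) * (L / m ^+ 2) * (2 * (w - u) * L) =
    ((w - u) * (C - 1)) * (w - u) by rewrite /C; ring.
  by apply: ler_wpM2r; nra.
- move=> e e0; pose C := 3 * L + 1.
  have C0 : 0 < C by rewrite /C; lra.
  exists (e / C); first by rewrite divr_gt0.
  move=> w w0 w1; rewrite /= p0 segL !subr0 [`|w|]ger0_norm // => wd.
  have wC : w * C <= e by rewrite ltW // -ltr_pdivlMr.
  have -> : `|phi w| = w * (w * (3 - 2 * w)).
    by rewrite ger0_norm; [rewrite /phi; ring | by have /andP[] := phi01 w w0 w1].
  rewrite -mulrA mulrC; apply: ler_wpM2r => //.
  by apply: le_trans wC; rewrite -mulrA; apply: ler_wpM2l => //; rewrite /C; nra.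
- move=> e e0; pose C := 3 * L + 1.
  have C0 : 0 < C by rewrite /C; lra.
  exists (e / C); first by rewrite divr_gt0.
  move=> w w0 w1; rewrite /= p1 segL ![`|_ - 1|]distrC.
  have w10 : 0 <= 1 - w by rewrite subr_ge0.
  rewrite [`|1 - w|]ger0_norm // => wd.
  have wC : (1 - w) * C <= e by rewrite ltW // -ltr_pdivlMr.
  have -> : `|1 - phi w| = (1 - w) * ((1 - w) * (1 + 2 * w)).
    by rewrite ger0_norm; [rewrite /phi; ring | have /andP[] := phi01 w w0 w1; lra].
  rewrite -mulrA mulrC; apply: ler_wpM2r => //.
  apply: le_trans wC; rewrite -mulrA; apply: ler_wpM2l => //.
  by rewrite /C; nra.
Qed.
End Curves.

Section Nodes.
Variable R : realType.
Implicit Types s : seq R.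

Lemma node0 s : node s 0 = 0.
Proof. by []. Qed.

Lemma node_size s : itv_partition 0 1 s -> node s (size s) = 1.
Proof. exact: itv_partition_nth_size. Qed.

Lemma node_itv s n : itv_partition 0 1 s -> (n <= size s)%N -> 0 <= node s n <= 1.
Proof.
move=> ps ns; apply/andP; split.
  by rewrite /node; apply: itv_partition_nth_ge.
by rewrite /node; apply: itv_partition_nth_le.
Qed.

Lemma node_le s n : itv_partition 0 1 s -> (n < size s)%N ->
  node s n <= node s n.+1.
Proof. by move=> [/(pathP 1) ps _] ns; apply: ltW; exact: ps. Qed.

Lemma uniform_partition (N : nat) : (0 < N)%N -> exists s : seq R,
  [/\ itv_partition 0 1 s, size s = N &
      forall n, (n <= N)%N -> node s n = n%:R / N%:R].
Proof.
move=> N0; pose s := [seq i%:R / N%:R : R | i <- iota 1 N].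
have NR : 0 < N%:R :> R by rewrite ltr0n.
have ns n : (n <= N)%N -> node s n = n%:R / N%:R.
  move=> nN; rewrite /node.
  have -> : 0 :: s = [seq i%:R / N%:R : R | i <- iota 0 N.+1] by rewrite /= mul0r.
  by rewrite (nth_map 0%N) ?size_iota// nth_iota.
have szs : size s = N by rewrite size_map size_iota.
exists s; split => //; split.
  apply/(pathP 1) => i; rewrite szs => iN.
  rewrite -/(node s i) -[nth 1 s i]/(node s i.+1) !ns //; last exact: ltnW.
  by rewrite ltr_pM2r ?invr_gt0// ltr_nat.
by rewrite (last_nth 1) szs -/(node s N) ns // divff// gt_eqF.
Qed.
End Nodes.

Lemma stationary_widen (R : realType) (X : normedModType R) (g : R -> X) (a b c : R) : a < c ->
  stationary_at g a c a -> stationary_at g a b a.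
Proof.
move=> ac S1 e e0; have [d1 d10 H1] := S1 _ e0.
exists (Num.min d1 (c - a)); first by rewrite lt_min d10 subr_gt0.
move=> t at_ tb; rewrite lt_min => /andP[td1 td2]; apply: H1 => //.
by move: td2; rewrite ger0_norm ?subr_ge0 // => td2; clear -td2; lra.
Qed.

Lemma stationary_widen_right (R : realType) (X : normedModType R) (g : R -> X) (a b c : R) : c < b ->
  stationary_at g c b b -> stationary_at g a b b.
Proof.
move=> cb S1 e e0; have [d1 d10 H1] := S1 _ e0.
exists (Num.min d1 (b - c)); first by rewrite lt_min d10 subr_gt0.
move=> t at_ tb; rewrite lt_min => /andP[td1 td2]; apply: H1 => //.
by move: td2; rewrite ler0_norm ?subr_le0 // => td2; clear -td2; lra.
Qed.

(** The only new intervals are those containing c in their interior; there the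
    speed is small near c and the weight is at most 1 / m. *)
Lemma tame_on_glue (R : realType) (X : normedModType R) (Omega : set X)
    (g : R -> X) V (a b c : R) : a < c -> c < b ->
  tame_on Omega g V a c -> tame_on Omega g V c b -> tame_on Omega g V a b.
Proof.
move=> ac cb [[m1 m10 O1] [K1 L1] C1 Sa S1] [[m2 m20 O2] [K2 L2] C2 S2 Sb].
pose m := Num.min m1 m2.
have m0 : 0 < m by rewrite lt_min m10.
have Og t : a <= t -> t <= b -> Omega (g t) /\ m <= bdist Omega (g t).
  move=> t0 t1; have [h|/ltW h] := leP t c.
    have [? h'] := O1 t t0 h; split=> //; apply: le_trans h'.
    by rewrite ge_min lexx.
  have [? h'] := O2 t h t1; split=> //; apply: le_trans h'.
  by rewrite ge_min lexx orbT.
clearbody m; split.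
- by exists m.
- pose K := `|K1| + `|K2|.
  have KK1 : K1 <= K by apply: (le_trans (ler_norm _)); rewrite lerDl.
  have KK2 : K2 <= K by apply: (le_trans (ler_norm _)); rewrite lerDr.
  have H1 u w : a <= u -> u <= w -> w <= c -> `|g w - g u| <= K * (w - u).
    move=> u0 uw w1; apply: (le_trans (L1 _ _ u0 uw w1)).
    by rewrite ler_wpM2r // subr_ge0.
  have H2 u w : c <= u -> u <= w -> w <= b -> `|g w - g u| <= K * (w - u).
    move=> u0 uw w1; apply: (le_trans (L2 _ _ u0 uw w1)).
    by rewrite ler_wpM2r // subr_ge0.
  exists K => u w u0 uw w1.
  have [wh|/ltW wh] := leP w c; first exact: H1.
  have [uh|/ltW uh] := leP u c; last exact: H2.
  have h1 := H1 u c u0 uh (lexx _); have h2 := H2 c w (lexx _) wh w1.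
  have := ler_distD (g c) (g w) (g u).
  by move: h1 h2; clear; lra.
- move=> e e0.
  have e20 : 0 < e / 4 by rewrite divr_gt0.
  have em0 : 0 < e * m / 4 by rewrite divr_gt0 // mulr_gt0.
  have [d1 d10 H1] := C1 _ e20; have [d2 d20 H2] := C2 _ e20.
  have [d3 d30 H3] := S1 _ em0; have [d4 d40 H4] := S2 _ em0.
  exists (Num.min (Num.min d1 d2) (Num.min d3 d4)).
    by rewrite !lt_min d10 d20 d30 d40.
  move=> u xi w u0 ux xw w1.
  rewrite !lt_min => /andP[/andP[wd1 wd2] /andP[wd3 wd4]].
  have uw := le_trans ux xw.
  have le4 : e / 4 * (w - u) <= e * (w - u).
    by apply: ler_wpM2r; rewrite ?subr_ge0 //; clear -e0; lra.
  have [wh|/ltW wh] := leP w c.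
    by apply: le_trans le4; apply: H1.
  have [uh|/ltW uh] := leP u c; last first.
    by apply: le_trans le4; apply: H2.
  (* the subinterval straddles c, where both pieces are stationary *)
  have A1 : `|g c - g u| <= e * m / 4 * (c - u).
    have E : `|u - c| = c - u by rewrite ler0_norm ?opprB // subr_le0.
    have := H3 u u0 uh; rewrite E distrC; apply.
    by move: wd3 wh; clear; lra.
  have A2 : `|g w - g c| <= e * m / 4 * (w - c).
    have E : `|w - c| = w - c by rewrite ger0_norm // subr_ge0.
    have := H4 w wh w1; rewrite E; apply.
    by move: wd4 uh; clear; lra.
  have [_ dh] := Og c (ltW ac) (ltW cb).
  have [_ dx] := Og xi (le_trans u0 ux) (le_trans xw w1).
  have B1 : `|(bdist Omega (g c))^-1 * `|g c - g u| - (V c - V u)| <= e / 4 * (c - u).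
    by apply: H1 => //; move: wd1 wh; clear; lra.
  have B2 : `|(bdist Omega (g c))^-1 * `|g w - g c| - (V w - V c)| <= e / 4 * (w - c).
    by apply: H2 => //; move: wd2 uh; clear; lra.
  have bnd q r z : m <= q -> 0 <= r -> r <= e * m / 4 * z -> 0 <= q^-1 * r <= e / 4 * z.
    move=> mq r0 rc; have q0 : 0 < q by exact: lt_le_trans mq.
    rewrite mulr_ge0 ?invr_ge0 ?(ltW q0) //=; apply: le_trans (_ : m^-1 * (e * m / 4 * z) <= _).
      by apply: ler_pM; rewrite ?invr_ge0 ?(ltW q0) // lef_pV2 ?posrE.
    by rewrite le_eqVlt; apply/orP; left; apply/eqP; field; rewrite gt_eqF.
  have /andP[b1 b1'] := bnd _ _ _ dh (normr_ge0 _) A1.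
  have /andP[b2 b2'] := bnd _ _ _ dh (normr_ge0 _) A2.
  have A3 : `|g w - g u| <= e * m / 4 * (w - u).
    by have := ler_distD (g c) (g w) (g u); move: A1 A2; clear; lra.
  have /andP[b3 b3'] := bnd _ _ _ dx (normr_ge0 _) A3.
  move: B1 B2 b1 b1' b2 b2' b3 b3' le4; rewrite !ler_norml.
  move: (_ * `|_|) (_ * `|g c - _|) (_ * `|g w - g c|) => r1 r2 r3.
  move=> /andP[B1 B1'] /andP[B2 B2'] b1 b1' b2 b2' b3 b3' le4.
  by clear -B1 B1' B2 B2' b1 b1' b2 b2' b3 b3' le4; apply/andP; split; lra.
- exact: stationary_widen Sa.
- exact: stationary_widen_right Sb.
Qed.

Lemma tame_on_ext (R : realType) (X : normedModType R) (Omega : set X)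
    (g g' : R -> X) (V V' : R -> R) (a b : R) : a <= b ->
  (forall t, a <= t -> t <= b -> g' t = g t /\ V' t = V t) ->
  tame_on Omega g V a b -> tame_on Omega g' V' a b.
Proof.
move=> ab gg [[m m0 O1] [K L1] C1 Sa Sb].
have E t : a <= t -> t <= b -> g' t = g t by move=> ? ?; have [] := gg t.
have EV t : a <= t -> t <= b -> V' t = V t by move=> ? ?; have [] := gg t.
split.
- by exists m => // t t0 t1; rewrite E //; exact: O1.
- exists K => u w u0 uw w1; rewrite !E ?(le_trans u0) ?(le_trans _ w1) //; exact: L1.
- move=> e e0; have [de de0 H] := C1 e e0; exists de => // u xi w u0 ux xw w1.
  have uw := le_trans ux xw.
  have [ub aw] : u <= b /\ a <= w by rewrite (le_trans uw w1) (le_trans u0 uw).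
  have [xb ax] : xi <= b /\ a <= xi by rewrite (le_trans xw w1) (le_trans u0 ux).
  by rewrite !E ?EV //; exact: H.
- move=> e e0; have [de de0 H] := Sa e e0; exists de => // t at_ tb.
  by rewrite !E //; exact: H.
- move=> e e0; have [de de0 H] := Sb e e0; exists de => // t at_ tb.
  by rewrite !E //; exact: H.
Qed.

Lemma tame_on_affine (R : realType) (X : normedModType R) (Omega : set X)
    (g : R -> X) V (l a b : R) : 0 < l -> tame_on Omega g V 0 1 ->
  b - a = l^-1 ->
  tame_on Omega (fun t => g (l * (t - a))) (fun t => V (l * (t - a))) a b.
Proof.
move=> l0 [[m m0 O1] [K L1] C1 Sa Sb] ab.
have i0 t : a <= t -> 0 <= l * (t - a).
  by move=> h; apply: mulr_ge0; [exact: ltW|rewrite subr_ge0].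
have lab : l * (b - a) = 1 by rewrite ab mulfV // gt_eqF.
have i1 t : t <= b -> l * (t - a) <= 1.
  by move=> h; rewrite -lab; apply: ler_wpM2l; [exact: ltW|rewrite lerD2r].
have mono u w : u <= w -> l * (u - a) <= l * (w - a).
  by move=> h; apply: ler_wpM2l; [exact: ltW|rewrite lerD2r].
have dif u w : l * (w - a) - l * (u - a) = l * (w - u) by ring.
have sc e : 0 < e -> 0 < e / l by move=> ?; rewrite divr_gt0.
have sc' e c : e / l * (l * c) = e * c by field; rewrite gt_eqF.
have scn c : `|l * c| = l * `|c| by rewrite normrM gtr0_norm.
split.
- by exists m => // t t0 t1; apply: O1; [exact: i0|exact: i1].
- exists (K * l) => u w u0 uw w1; rewrite -mulrA -(dif u w).
  exact: (L1 _ _ (i0 _ u0) (mono _ _ uw) (i1 _ w1)).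
- move=> e e0; have [de de0 H] := C1 _ (sc _ e0).
  exists (de / l); first by rewrite divr_gt0.
  move=> u xi w u0 ux xw w1; rewrite ltr_pdivlMr // mulrC -dif => wu.
  have := H _ _ _ (i0 _ u0) (mono _ _ ux) (mono _ _ xw) (i1 _ w1) wu.
  by rewrite dif sc'.
- move=> e e0; have [de de0 H] := Sa _ (sc _ e0).
  exists (de / l); first by rewrite divr_gt0.
  move=> t t0 t1; rewrite subrr mulr0 ltr_pdivlMr // mulrC -scn => wu.
  have := H _ (i0 _ t0) (i1 _ t1); rewrite subr0 => /(_ wu).
  by rewrite scn sc'.
- move=> e e0; have [de de0 H] := Sb _ (sc _ e0).
  exists (de / l); first by rewrite divr_gt0.
  move=> t t0 t1; rewrite lab ltr_pdivlMr // mulrC -scn => wu.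
  have E : l * (t - a) - 1 = l * (t - b) by rewrite -lab; ring.
  have := H _ (i0 _ t0) (i1 _ t1); rewrite E => /(_ wu).
  by rewrite scn sc'.
Qed.

(** Each piece is run through at double speed on one half of [0, 1]. *)
Lemma tame_cat (R : realType) (X : normedModType R) (Omega : set X)
    x y z I J : tame_curve Omega x y I -> tame_curve Omega y z J ->
  tame_curve Omega x z (I + J).
Proof.
move=> [g1 [V1 [g10 g11 V1I T1]]] [g2 [V2 [g20 g21 V2J T2]]].
pose h : R := 2^-1.
have h0 : 0 < h by rewrite invr_gt0.
have h1 : h < 1 by rewrite invf_lt1 // ltrDl.
have l0 : 0 < 2 :> R by [].
have lh : 2 * h = 1 by rewrite mulfV.
pose g t := if t <= h then g1 (2 * (t - 0)) else g2 (2 * (t - h)).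
pose V t := if t <= h then V1 (2 * (t - 0)) else V1 1 + (V2 (2 * (t - h)) - V2 0).
have h10 : h - 0 = 2^-1 by rewrite subr0.
have h11 : 1 - h = 2^-1 by rewrite -lh /h; clear; lra.
have E1 := tame_on_affine l0 T1 h10.
have E2 := tame_on_affine l0 T2 h11.
exists g, V; split.
- by rewrite /g (ltW h0) subrr mulr0.
- by rewrite /g leNgt h1 /= h11 mulfV.
- rewrite /V (ltW h0) leNgt h1 /= h11 mulfV // subrr mulr0 V2J -V1I; ring.
apply: (tame_on_glue h0 h1).
  apply: tame_on_ext (ltW h0) _ E1 => t t0 th.
  by rewrite /g /V th.
have E3 : tame_on Omega (fun t => g2 (2 * (t - h)))
    (fun t => V1 1 + (V2 (2 * (t - h)) - V2 0)) h 1.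
  have [A B C D E] := E2; split=> //.
  move=> e e0; have [de de0 H] := C e e0; exists de => // u xi w u0 ux xw w1 wu.
  rewrite (_ : V1 1 + _ - _ = V2 (2 * (w - h)) - V2 (2 * (u - h))); first exact: H.
  by ring.
apply: tame_on_ext (ltW h1) _ E3 => t; rewrite le_eqVlt => /orP[/eqP <- _|th t1].
  by rewrite /g /V lexx subr0 lh subrr mulr0 g11 g20 subrr addr0.
by rewrite /g /V leNgt th.
Qed.

(** * The quasihyperbolic metric through broken lines *)

(** Broken lines with n edges from x to y, run through in total time T. An edge
    is allotted a time tau at least equal to its cost; the slack lets two broken
    lines be given the same total time. *)
Fixpoint chain (R : realType) (X : normedModType R) (Omega : set X)
    (n : nat) (T : R) (x y : X) : Prop :=
  if n is n'.+1 then exists z tau, [/\ Omega z, 0 < tau,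
    `|z - x| <= tau * Num.min (bdist Omega x) (bdist Omega z) &
    chain Omega n' (T - tau) z y]
  else x = y /\ T = 0.

Definition qh_integrals (R : realType) (X : normedModType R) (Omega : set X) (x y : X) :=
  [set I : R | exists g, [/\ is_curve Omega x y g, rectifiable g &
         is_line_integral (fun z => (bdist Omega z)^-1) g I]].

Lemma chain_ge0 (R : realType) (X : normedModType R) (Omega : set X) n (T : R) (x y : X) :
  chain Omega n T x y -> 0 <= T.
Proof.
elim: n T x => [|n IH] T x /=; first by move=> [_ ->].
move=> [z [tau [_ t0 _ /IH]]]; rewrite subr_ge0; apply: le_trans; exact: ltW.
Qed.

Lemma chain_of_points (R : realType) (X : normedModType R) (Omega : set X)
    N (p : nat -> X) (tau : nat -> R) :
  (forall i, (i < N)%N -> [/\ Omega (p i.+1), 0 < tau i &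
    `|p i.+1 - p i| <= tau i * Num.min (bdist Omega (p i)) (bdist Omega (p i.+1))]) ->
  chain Omega N (\sum_(0 <= i < N) tau i) (p 0%N) (p N).
Proof.
elim: N p tau => [|N IH] p tau H /=; first by rewrite big_nil.
have [p1 t0 pt] := H 0%N isT.
exists (p 1%N), (tau 0%N); split => //.
rewrite big_nat_recl // addrAC subrr add0r.
by apply: (IH (p \o succn) (tau \o succn)) => i iN; exact: H.
Qed.

(** A Riemann-Stieltjes sum whose tags are the endpoints with the smaller d is
    the cost of the inscribed broken line. *)
Lemma line_integral_chain (R : realType) (X : normedModType R) (Omega : set X)
    (x y : X) g (I eta : R) : open Omega -> boundary Omega !=set0 ->
  is_curve Omega x y g -> is_line_integral (fun z => (bdist Omega z)^-1) g I ->
  0 < eta -> exists n T, chain Omega n T x y /\ T < I + eta.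
Proof.
move=> openO bdO [_ Og g0 g1] gI eta0.
have eta20 : 0 < eta / 2 by rewrite divr_gt0.
have [de de0 H] := gI _ eta20.
pose N := (Num.Def.trunc de^-1).+1.
have NR : 0 < N%:R :> R by rewrite ltr0n.
have [s [ps sz nd]] := @uniform_partition R N isT.
pose D n := bdist Omega (g (node s n)).
(* half of eta pays for the Riemann-Stieltjes error, the other half makes every
   edge time positive *)
pose xi n := if D n <= D n.+1 then node s n else node s n.+1.
have Onode n : (n <= N)%N -> Omega (g (node s n)).
  by move=> nN; apply: Og; rewrite in_itv /=; apply: node_itv => //; rewrite sz.
have xiD n : bdist Omega (g (xi n)) = Num.min (D n) (D n.+1).
  by rewrite /xi; case: (leP (D n) (D n.+1)).
have {H} := H s xi ps; rewrite sz => H.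
have {}H := H _; set S := \sum_(0 <= n < N) _ in H.
have SI : S < I + eta / 2.
  rewrite -ltrBlDl; apply: (le_lt_trans (ler_norm _)); apply: H => n nN.
  have nle : node s n <= node s n.+1 by apply: node_le => //; rewrite sz.
  split; first by rewrite /xi; case: ifP => _; rewrite lexx ?nle.
  rewrite !nd // 1?ltnW // -mulrBl -natrB // subSn // subnn mul1r.
  by rewrite -[ltRHS]invrK ltf_pV2 ?posrE ?invr_gt0 //; apply: truncnS_gt.
exists N, (\sum_(0 <= n < N) ((bdist Omega (g (xi n)))^-1 *
    `|g (node s n.+1) - g (node s n)| + eta / 2 / N%:R)); split.
  have -> : x = g (node s 0%N) by rewrite node0 g0.
  have -> : y = g (node s N) by rewrite -sz node_size.
  apply: (chain_of_points (p := fun n => g (node s n))) => i iN.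
  have D1 := bdist_gt0 openO bdO (Onode i (ltnW iN)).
  have D2 := bdist_gt0 openO bdO (Onode i.+1 iN).
  have M0 : 0 < Num.min (D i) (D i.+1) by rewrite lt_min D1.
  split; first exact: Onode.
    by rewrite ltr_wpDl ?divr_gt0 // mulr_ge0 // invr_ge0 xiD ltW.
  rewrite xiD mulrDl mulrAC mulVf ?gt_eqF // mul1r lerDl.
  by rewrite ltW // mulr_gt0 // divr_gt0.
rewrite big_split /= -/S big_const_nat subn0 iter_addr addr0 -[X in _ + X]mulr_natr.
by rewrite divfK ?gt_eqF // -ltrBrDr; move: SI; lra.
Qed.

Lemma tame_admissible (R : realType) (X : normedModType R) (Omega : set X) (x y : X) (I : R) :
  tame_curve Omega x y I -> qh_integrals Omega x y I.
Proof.
move=> [g [V [g0 g1 V1I [[m m0 Og] [K L] C _ _]]]]; exists g; split.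
- split => //; last by move=> t; rewrite in_itv /= => /andP[t0 t1]; have [] := Og t t0 t1.
  apply/subspace_continuousP => t; rewrite /= in_itv /= => /andP[t0 t1].
  apply/cvgrPdist_lt => e e0.
  have K0 : 0 < `|K| + 1 by rewrite ltr_wpDl.
  have L' u w : 0 <= u -> u <= w -> w <= 1 -> `|g w - g u| <= (`|K| + 1) * (w - u).
    move=> h1 h2 h3; apply: (le_trans (L _ _ h1 h2 h3)).
    by rewrite ler_wpM2r ?subr_ge0 // (le_trans (ler_norm _)) // lerDl.
  apply/nbhs_ballP; exists (e / (`|K| + 1)) => /=; first by rewrite divr_gt0.
  move=> s /=; rewrite /ball /= ltr_pdivlMr // mulrC => ts; rewrite in_itv /= => /andP[s0 s1].
  apply: le_lt_trans ts; have [h|/ltW h] := leP s t.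
    by rewrite [`|t - s|]ger0_norm ?subr_ge0 //; exact: L'.
  by rewrite distrC [`|t - s|]distrC [`|s - t|]ger0_norm ?subr_ge0 //; exact: L'.
- exists K => _ [s ps <-].
  apply: (@le_trans _ _ (\sum_(0 <= n < size s) (K * node s n.+1 - K * node s n))).
    apply: ler_sum_nat => n /= ns; rewrite -mulrBr.
    have /andP[? _] := node_itv ps (ltnW ns); have /andP[_ ?] := node_itv ps ns.
    by apply: L => //; apply: node_le.
  by rewrite telescope_sumr // node_size // node0 mulr0 subr0 mulr1.
- move=> e e0; have e20 : 0 < e / 2 by rewrite divr_gt0.
  have [de de0 H] := C _ e20; exists de => // s xi ps Hxi.
  have <- : V (node s (size s)) - V (node s 0%N) = I by rewrite node_size // node0.
  rewrite -(telescope_sumr (fun n => V (node s n))) // -sumrB.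
  apply: (le_lt_trans (ler_norm_sum _ _ _)).
  apply: (@le_lt_trans _ _ (\sum_(0 <= n < size s) (e / 2 * node s n.+1 - e / 2 * node s n))).
    apply: ler_sum_nat => n /= ns; rewrite -mulrBr.
    have /andP[? _] := node_itv ps (ltnW ns); have /andP[_ ?] := node_itv ps ns.
    by have [/andP[? ?] ?] := Hxi n ns; apply: H.
  rewrite telescope_sumr // node_size // node0 mulr0 subr0 mulr1.
  by rewrite ltr_pdivrMr // ltr_pMr // ltr1n.
Qed.

Definition convex_domain (R : realType) (X : normedModType R) (Omega : set X) :=
  [/\ open Omega, boundary Omega !=set0 &
   forall a b (l : R), Omega a -> Omega b -> 0 <= l <= 1 -> Omega (l *: a + (1 - l) *: b)].

Section Metric.
Variables (R : realType) (X : normedModType R) (Omega : set X).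
Hypothesis domO : convex_domain Omega.
Implicit Types x y z : X.

Let openO : open Omega. Proof. by case: domO. Qed.
Let bdO : boundary Omega !=set0. Proof. by case: domO. Qed.
Let convO : forall a b (l : R), Omega a -> Omega b -> 0 <= l <= 1 ->
  Omega (l *: a + (1 - l) *: b). Proof. by case: domO. Qed.

Lemma qh_integrals_ge0 x y I : qh_integrals Omega x y I -> 0 <= I.
Proof.
move=> [g [gc _ gI]]; apply/ler_addgt0Pr => e e0.
have [n [T [/chain_ge0 T0 TI]]] := line_integral_chain openO bdO gc gI e0.
exact: le_trans (ltW TI).
Qed.

Lemma qh_le_tame x y I : tame_curve Omega x y I -> quasihyperbolic Omega x y <= I.
Proof.
move=> /tame_admissible H; apply: ge_inf; last exact: H.
by exists 0 => J; exact: qh_integrals_ge0.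
Qed.

Lemma qh_le_edge x y : Omega x -> Omega y -> quasihyperbolic Omega x y <=
  `|y - x| / Num.min (bdist Omega x) (bdist Omega y).
Proof.
move=> Ox Oy; have [I I1 /qh_le_tame I2] := tame_segment openO bdO convO Ox Oy.
exact: le_trans I1.
Qed.

Lemma qh_chain x y eta : Omega x -> Omega y -> 0 < eta ->
  exists n T, chain Omega n T x y /\ T < quasihyperbolic Omega x y + eta.
Proof.
move=> Ox Oy eta0; have eta20 : 0 < eta / 2 by rewrite divr_gt0.
have [I0 _ /tame_admissible S0] := tame_segment openO bdO convO Ox Oy.
have hi : has_inf (qh_integrals Omega x y).
  by split; [exists I0|exists 0 => J; exact: qh_integrals_ge0].
have [I [g [gc _ gI]] Ik] := inf_adherent eta20 hi.
have [n [T [H TI]]] := line_integral_chain openO bdO gc gI eta20.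
exists n, T; split=> //; rewrite -/(quasihyperbolic _ _ _) in Ik.
by move: TI Ik; lra.
Qed.

Lemma chain_tame n T x y : Omega x -> (0 < n)%N -> chain Omega n T x y ->
  exists2 I, I <= T & tame_curve Omega x y I.
Proof.
elim: n T x => // -[|n] IH T x Ox _ [z [tau [Oz tau0 xz H]]];
  have [I It TI] := tame_segment openO bdO convO Ox Oz;
  have Itau : I <= tau by
    (apply: (le_trans It); rewrite ler_pdivrMr // lt_min !(bdist_gt0 openO bdO)).
  move: H => /= [<- /eqP]; rewrite subr_eq0 => /eqP ->.
  by exists I.
have [J JT TJ] := IH _ _ Oz isT H.
exists (I + J); last exact: tame_cat TJ.
by move: Itau JT; lra.
Qed.

Lemma qhxx x : Omega x -> quasihyperbolic Omega x x = 0.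
Proof.
move=> Ox; apply/eqP; rewrite eq_le; apply/andP; split.
  by apply: (le_trans (qh_le_edge Ox Ox)); rewrite subrr normr0 mul0r.
have [I0 _ /tame_admissible S0] := tame_segment openO bdO convO Ox Ox.
by apply: lb_le_inf; [exists I0|move=> J; exact: qh_integrals_ge0].
Qed.

Lemma qh_le_chain n T x y : Omega x -> chain Omega n T x y ->
  quasihyperbolic Omega x y <= T.
Proof.
case: n => [|n] Ox H; first by move: H => [<- ->]; rewrite qhxx.
have [I IT /qh_le_tame] := chain_tame Ox (ltn0Sn n) H.
by move=> /le_trans; apply.
Qed.

Lemma chain_cat n m S T x y z : chain Omega n S x y -> chain Omega m T y z ->
  chain Omega (n + m) (S + T) x z.
Proof.
elim: n S x => [|n IH] S x /=; first by move=> [<- ->]; rewrite add0r.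
move=> [w [tau [Ow t0 xw H]]] /(IH _ _ H) K; exists w, tau; split => //.
by rewrite addrAC.
Qed.

Lemma qh_triangle x y z : Omega x -> Omega y -> Omega z ->
  quasihyperbolic Omega x z <= quasihyperbolic Omega x y + quasihyperbolic Omega y z.
Proof.
move=> Ox Oy Oz; apply/ler_addgt0Pr => e e0; have e20 : 0 < e / 2 by rewrite divr_gt0.
have [n [S [H SI]]] := qh_chain Ox Oy e20; have [m [T [K TI]]] := qh_chain Oy Oz e20.
apply: (le_trans (qh_le_chain Ox (chain_cat H K))).
by move: SI TI; lra.
Qed.
End Metric.

(** * Cutting and averaging broken lines *)

Section Geometry.
Variables (R : realType) (X : normedModType R) (Omega : set X).
Hypothesis domO : convex_domain Omega.
Implicit Types x y z a b : X.

Let openO : open Omega. Proof. by case: domO. Qed.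
Let bdO : boundary Omega !=set0. Proof. by case: domO. Qed.
Let convO : forall a b (l : R), Omega a -> Omega b -> 0 <= l <= 1 ->
  Omega (l *: a + (1 - l) *: b). Proof. by case: domO. Qed.

Notation d z := (bdist Omega z).
Notation k := (quasihyperbolic Omega).

Lemma qh_ge0 x y : Omega x -> Omega y -> 0 <= k x y.
Proof.
move=> Ox Oy; apply/ler_addgt0Pr => e e0.
by have [n [T [/chain_ge0 T0 /ltW]]] := qh_chain domO Ox Oy e0; exact: le_trans.
Qed.

(** Once a broken line has entered the ball of radius r around y for the last
    time, d is at most d y + r; the edge entering the ball is covered because
    its weight is governed by the smaller of the two endpoint values. *)
Lemma chain_lower n (T r : R) z y : 0 < r -> Omega y -> chain Omega n T z y ->
  Num.min `|z - y| r <= T * (d y + r).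
Proof.
move=> r0 Oy; have dy := bdist_gt0 openO bdO Oy.
elim: n T z => [|n IH] T z /=.
  by move=> [-> ->]; rewrite subrr normr0 mul0r ge_min lexx.
move=> [z' [tau [Oz' t0 zz' H]]]; have := IH _ _ H.
have tr : 0 <= tau * (d y + r) by rewrite mulr_ge0 ?addr_ge0 ?ltW.
rewrite mulrBl; have [rz|rz] := leP r `|z' - y| => h.
  by rewrite ge_min; apply/orP; right; move: h tr; lra.
rewrite ge_min; apply/orP; left.
have dz' : d z' <= d y + r.
  by have := set_dist_lipschitz z' y bdO; move: rz; lra.
have : `|z' - z| <= tau * (d y + r).
  by apply: (le_trans zz'); rewrite ler_pM2l // ge_min dz' orbT.
have := ler_distD z' z y; rewrite [`|z - z'|]distrC.
by move: h; lra.
Qed.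

Lemma qh_lower z y : Omega z -> Omega y -> `|z - y| <= k z y * (d y + `|z - y|).
Proof.
move=> Oz Oy; have dy := bdist_gt0 openO bdO Oy.
have [->|zy] := eqVneq z y; first by rewrite subrr normr0 addr0 mulr_ge0 ?qh_ge0 ?ltW.
have r0 : 0 < `|z - y| by rewrite normr_gt0 subr_eq0.
have s0 : 0 < d y + `|z - y| by rewrite addr_gt0.
rewrite -ler_pdivrMr //; apply/ler_addgt0Pr => e e0.
have [n [T [H /ltW]]] := qh_chain domO Oz Oy e0.
apply: le_trans; rewrite ler_pdivrMr //.
by have := chain_lower r0 Oy H; rewrite minxx.
Qed.

(** Cutting an edge is free: d on the edge is at least its minimum at the ends,
    so both parts keep the original speed bound. *)
Lemma edge_split x x' (tau s : R) : Omega x -> Omega x' ->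
  `|x' - x| <= tau * Num.min (d x) (d x') -> 0 <= tau -> 0 <= s <= 1 ->
  let z := x + s *: (x' - x) in
  [/\ Omega z, `|z - x| <= (s * tau) * Num.min (d x) (d z) &
     `|x' - z| <= ((1 - s) * tau) * Num.min (d z) (d x')].
Proof.
move=> Ox Ox' H tau0 s01 z; have /andP[s0 s1] := s01.
have zE : z = s *: x' + (1 - s) *: x.
  by rewrite /z scalerBr scalerBl scale1r addrCA addrA addrC addrA.
have Oz : Omega z by rewrite zE; apply: convO.
set m := Num.min (d x) (d x') in H.
have mx : m <= d x by rewrite ge_min lexx.
have mx' : m <= d x' by rewrite ge_min lexx orbT.
have mz : m <= d z.
  rewrite zE; apply: le_trans (bdist_concave openO bdO convO Ox' Ox s01).
  by move: mx mx'; clearbody m; nra.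
split => //.
  have -> : z - x = s *: (x' - x) by rewrite /z addrC addKr.
  rewrite normrZ ger0_norm // -mulrA ler_wpM2l // (le_trans H) // ler_wpM2l //.
  by rewrite le_min mx.
have -> : x' - z = (1 - s) *: (x' - x) by rewrite /z scalerBl scale1r opprD addrA.
rewrite normrZ ger0_norm ?subr_ge0 // -mulrA ler_wpM2l ?subr_ge0 // (le_trans H) // ler_wpM2l //.
by rewrite le_min mx'  mz.
Qed.

Lemma qh_le_edge_time x y (tau : R) : Omega x -> Omega y ->
  `|y - x| <= tau * Num.min (d x) (d y) -> k x y <= tau.
Proof.
move=> Ox Oy H; apply: (le_trans (qh_le_edge domO Ox Oy)).
by rewrite ler_pdivrMr // lt_min !(bdist_gt0 openO bdO).
Qed.

(** The cut is made on the first edge that enters the ball of radius eps around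
    y, at the point found by the intermediate value theorem. *)
Lemma chain_cut n (T eps : R) x y : Omega x -> Omega y -> 0 <= eps -> eps <= `|x - y| ->
  chain Omega n T x y ->
  exists z, [/\ Omega z, `|z - y| = eps & k x z + k z y <= T].
Proof.
move=> + Oy eps0; elim: n T x => [|n IH] T x Ox exy /=.
  move=> [xy ->]; exists y; rewrite xy subrr normr0 in exy *.
  by rewrite !(qhxx domO) // addr0; split=> //; apply/eqP; rewrite eq_le eps0.
move=> [x' [tau [Ox' t0 xx' H]]].
have [ex'|/ltW ex'] := leP eps `|x' - y|.
  have [z [Oz ze K]] := IH _ _ Ox' ex' H; exists z; split=> //.
  have := qh_triangle domO Ox Ox' Oz; have := qh_le_edge_time Ox Ox' xx'.
  by move: K; lra.
pose f (s : R) : R := `|x + s *: (x' - x) - y|.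
have cf : {within `[0, 1], continuous f}.
  apply: continuous_subspaceT => s; apply: cvg_norm.
  apply: cvgB; last exact: cvg_cst; apply: cvgD; first exact: cvg_cst.
  by apply: cvgZr_tmp.
have f0 : f 0 = `|x - y| by rewrite /f scale0r addr0.
have f1 : f 1 = `|x' - y| by rewrite /f scale1r [x + _]addrC subrK.
have [|s] := @IVT R f 0 1 eps ler01 cf.
  by rewrite f0 f1 ge_min le_max exy ex' orbT.
rewrite in_itv /= => s01 fs.
have [Oz h1 h2] := edge_split Ox Ox' xx' (ltW t0) s01.
exists (x + s *: (x' - x)); split => //.
have := qh_le_edge_time Ox Oz h1; have := qh_le_edge_time Oz Ox' h2.
have := qh_triangle domO Oz Ox' Oy; have := qh_le_chain domO Ox' H.
by lra.
Qed.

Lemma qh_cut x y (eps eta : R) : Omega x -> Omega y -> 0 <= eps -> eps <= `|x - y| ->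
  0 < eta -> exists z, [/\ Omega z, `|z - y| = eps & k x z + k z y <= k x y + eta].
Proof.
move=> Ox Oy eps0 exy eta0; have [n [T [H /ltW TI]]] := qh_chain domO Ox Oy eta0.
have [z [Oz ze K]] := chain_cut Ox Oy eps0 exy H.
by exists z; split=> //; exact: le_trans TI.
Qed.

(** The average of two edges of the same duration: the weighted mean of the two
    speed bounds is allowed because d is concave. *)
Lemma edge_convex (l tau : R) x x' z z' : 0 <= l <= 1 -> 0 <= tau ->
  Omega x -> Omega x' -> Omega z -> Omega z' ->
  `|z - x| <= tau * Num.min (d x) (d z) -> `|z' - x'| <= tau * Num.min (d x') (d z') ->
  `|l *: z + (1 - l) *: z' - (l *: x + (1 - l) *: x')| <=
  tau * Num.min (d (l *: x + (1 - l) *: x')) (d (l *: z + (1 - l) *: z')).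
Proof.
move=> l01 tau0 Ox Ox' Oz Oz' H H'; have /andP[l0 l1] := l01.
have cu := bdist_concave openO bdO convO Ox Ox' l01.
have cv := bdist_concave openO bdO convO Oz Oz' l01.
set u := l *: x + _; set v := l *: z + _.
have -> : v - u = l *: (z - x) + (1 - l) *: (z' - x').
  by rewrite /u /v opprD addrACA -!scalerBr.
apply: (le_trans (ler_normD _ _)); rewrite !normrZ !ger0_norm ?subr_ge0 //.
set m := Num.min (d x) _ in H; set m' := Num.min (d x') _ in H'.
apply: (@le_trans _ _ (tau * (l * m + (1 - l) * m'))).
  have : l * `|z - x| <= l * (tau * m) by rewrite ler_wpM2l.
  have : (1 - l) * `|z' - x'| <= (1 - l) * (tau * m') by rewrite ler_wpM2l ?subr_ge0.
  by lra.
apply: ler_wpM2l => //; rewrite le_min; apply/andP; split.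
  by apply: le_trans cu; apply: lerD; rewrite ler_wpM2l ?subr_ge0 // ge_min lexx.
by apply: le_trans cv; apply: lerD; rewrite ler_wpM2l ?subr_ge0 // ge_min lexx orbT.
Qed.

(** The line whose first edge lasts longer has that edge cut, so that both lines
    start with edges of the same duration, which are averaged; each step uses up
    at least one edge. Equal total times make both lines end together. *)
Lemma chain_merge (l : R) N n m (T : R) x x' a b : 0 <= l <= 1 -> (n + m <= N)%N ->
  Omega x -> Omega x' -> chain Omega n T x a -> chain Omega m T x' b ->
  exists p, chain Omega p T (l *: x + (1 - l) *: x') (l *: a + (1 - l) *: b).
Proof.
move=> l01; elim: N n m T x x' => [|N IH] [|n] [|m] T x x' //= nmN Ox Ox'.
- by move=> [-> ->] [-> _]; exists 0%N.
- by move=> [-> ->] [-> _]; exists 0%N.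
- move=> [_ ->] [z [tau [_ t0 _ /chain_ge0]]]; rewrite sub0r oppr_ge0 => h.
  by move: (lt_le_trans t0 h); rewrite ltxx.
- move=> + [_ T0]; rewrite T0 => -[z [tau [_ t0 _ /chain_ge0]]]; rewrite sub0r oppr_ge0 => h.
  by move: (lt_le_trans t0 h); rewrite ltxx.
move=> [z [tau [Oz t0 xz H]]] [z' [sigma [Oz' s0 xz' H']]].
have [ts|st|ts] := ltgtP tau sigma.
- have sig0 : sigma != 0 by rewrite gt_eqF.
  have q01 : 0 <= tau / sigma <= 1.
    by apply/andP; split; [rewrite divr_ge0 // ltW|rewrite ler_pdivrMr // mul1r ltW].
  have [Ow h1 h2] := edge_split Ox' Oz' xz' (ltW s0) q01.
  set w := x' + _ in Ow h1 h2.
  have H2 : chain Omega m.+1 (T - tau) w b.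
    exists z', (sigma - tau); split => //; first by rewrite subr_gt0.
      by rewrite mulrBl mul1r divfK // in h2.
    by rewrite opprB addrA subrK.
  have [|p K] := IH n m.+1 _ _ _ _ Oz Ow H H2; first by move: nmN; rewrite !(addSn, addnS) ltnS.
  exists p.+1, (l *: z + (1 - l) *: w), tau; split => //; first exact: convO.
  by apply: edge_convex => //; [exact: ltW|rewrite divfK // in h1].
- have tau0 : tau != 0 by rewrite gt_eqF.
  have q01 : 0 <= sigma / tau <= 1.
    by apply/andP; split; [rewrite divr_ge0 // ltW|rewrite ler_pdivrMr // mul1r ltW].
  have [Ow h1 h2] := edge_split Ox Oz xz (ltW t0) q01.
  set w := x + _ in Ow h1 h2.
  have H2 : chain Omega n.+1 (T - sigma) w a.
    exists z, (tau - sigma); split => //; first by rewrite subr_gt0.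
      by rewrite mulrBl mul1r divfK // in h2.
    by rewrite opprB addrA subrK.
  have [|p K] := IH n.+1 m _ _ _ _ Ow Oz' H2 H'; first by move: nmN; rewrite !(addSn, addnS) ltnS.
  exists p.+1, (l *: w + (1 - l) *: z'), sigma; split => //; first exact: convO.
  by apply: edge_convex => //; [exact: ltW|rewrite divfK // in h1].
- rewrite -ts in H' xz'.
  have [|p K] := IH n m _ _ _ _ Oz Oz' H H'.
    by move: nmN; rewrite !(addSn, addnS) ltnS; apply: leq_trans.
  exists p.+1, (l *: z + (1 - l) *: z'), tau; split => //; first exact: convO.
  by apply: edge_convex => //; exact: ltW.
Qed.

(** Waiting at the starting point. *)
Lemma chain_pad n (T T' : R) x y : Omega x -> T < T' -> chain Omega n T x y ->
  chain Omega n.+1 T' x y.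
Proof.
move=> Ox TT H; exists x, (T' - T); split => //; first by rewrite subr_gt0.
  rewrite subrr normr0 mulr_ge0 ?subr_ge0 ?ltW // lt_min.
  by rewrite !(bdist_gt0 openO bdO).
by rewrite opprB addrC subrK.
Qed.

Lemma qh_quasiconvex x a b (l M : R) : Omega x -> Omega a -> Omega b -> 0 <= l <= 1 ->
  k x a <= M -> k x b <= M -> k x (l *: a + (1 - l) *: b) <= M.
Proof.
move=> Ox Oa Ob l01 aM bM; apply/ler_addgt0Pr => e e0.
have [n [T [H TM]]] := qh_chain domO Ox Oa e0.
have [m [S [K SM]]] := qh_chain domO Ox Ob e0.
have {}TM : T < M + e by move: TM aM; lra.
have {}SM : S < M + e by move: SM bM; lra.
have [p] := chain_merge l01 (leqnn _) Ox Ox (chain_pad Ox TM H) (chain_pad Ox SM K).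
by rewrite -scalerDl [l + _]addrC subrK scale1r => /(qh_le_chain domO Ox).
Qed.
End Geometry.

(** * Local estimates for the metric *)

Lemma uniformly_smooth_norm (R : realType) (X : normedModType R) (e : R) :
  uniformly_smooth X -> 0 < e -> exists tau : R, 0 < tau <= 1 /\
  forall v h : X, `|h| <= tau * `|v| -> `|v + h| + `|v - h| <= 2 * `|v| + e * `|h|.
Proof.
move=> US e0; have e20 : 0 < e / 2 by rewrite divr_gt0.
have /cvgrPdist_lt/(_ _ e20)/nbhs_ballP[t0 /= t00 H] := US.
exists (Num.min (t0 / 2) 1); split.
  by apply/andP; split; rewrite ?lt_min ?divr_gt0 ?ltr01 // ge_min lexx orbT.
move=> v h hv.
have [h0|h0] := eqVneq h 0.
  by rewrite h0 addr0 subr0 normr0 mulr0 addr0 mulr_natl mulr2n.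
have hn : 0 < `|h| by rewrite normr_gt0.
have [v0|v0] := eqVneq v 0.
  by move: hv; rewrite v0 normr0 mulr0 leNgt hn.
have vn : 0 < `|v| by rewrite normr_gt0.
pose t := `|h| / `|v|.
have tt0 : 0 < t by rewrite divr_gt0.
have tlt : t < t0.
  have : t <= Num.min (t0 / 2) 1 by rewrite ler_pdivrMr.
  by rewrite le_min => /andP[t1 _]; apply: (le_lt_trans t1); rewrite ltr_pdivrMr // ltr_pMr // ltr1n.
have bt : ball (0 : R) t0 t by rewrite /ball /= sub0r normrN gtr0_norm.
have {H} := H t bt tt0; rewrite sub0r normrN => /(le_lt_trans (ler_norm _)).
rewrite ltr_pdivrMr // => H.
pose y := `|v|^-1 *: v; pose g := `|v|^-1 *: h.
have yn : `|y| = 1 by rewrite normrZ gtr0_norm ?invr_gt0 // mulVf // gt_eqF.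
have gn : `|g| = t by rewrite normrZ gtr0_norm ?invr_gt0 // mulrC.
have : (`|y + g| + `|y - g|) / 2 - 1 <= smoothness_modulus X t.
  apply: ub_le_sup; last by exists y, g.
  exists t => _ [y' [h' [y1 h1 ->]]].
  have := ler_normD y' h'; have := ler_normB y' h'; rewrite y1 h1.
  by clear; lra.
have -> : `|y + g| = `|v + h| / `|v|.
  by rewrite -scalerDr normrZ gtr0_norm ?invr_gt0 // mulrC.
have -> : `|y - g| = `|v - h| / `|v|.
  by rewrite -scalerBr normrZ gtr0_norm ?invr_gt0 // mulrC.
move=> H2; have {H H2} := le_lt_trans H2 H; rewrite -mulrDl /t.
move: vn; move: (`|v + h| + `|v - h|) `|v| `|h| => p q r q0.
rewrite mulrA ltrBlDr => H.
have {H} : p / q / 2 * (2 * q) < (e / 2 * r / q + 1) * (2 * q) by rewrite ltr_pM2r // mulr_gt0.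
have -> : p / q / 2 * (2 * q) = p by field; rewrite gt_eqF.
have -> : (e / 2 * r / q + 1) * (2 * q) = 2 * q + e * r by field; rewrite gt_eqF.
exact: ltW.
Qed.

(** With dl = d a and D = f a - f b, the length eps is chosen so that a point at
    distance eps from a is at quasihyperbolic distance at least
    eps / (dl + eps) = D from a; the last bound compares the cost of returning
    from that point with D. *)
Lemma cut_length_bounds (R : realType) (dl s D : R) : 0 < dl -> 0 <= s -> 40 * s <= dl ->
  0 <= D -> D * (dl - s) <= s ->
  let eps := dl * D / (1 - D) in
  [/\ 0 <= eps, eps = D * (dl + eps), eps <= 3 * s &
      eps / (dl - 4 * s) <= D + 28 / dl ^+ 2 * s ^+ 2].
Proof.
move=> dl0 s0 sd D0 Ds eps.
have D1 : D <= 1 / 39.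
  rewrite leNgt; apply/negP => h; have : 1 / 39 * (dl - s) < s.
    by apply: lt_le_trans Ds; rewrite ltr_pM2r //; lra.
  lra.
have D10 : 0 < 1 - D by lra.
have eps0 : 0 <= eps by rewrite divr_ge0 ?mulr_ge0 // ltW.
have epsE : eps = D * (dl + eps) by rewrite /eps; field; rewrite gt_eqF.
have dD : dl * D * 39 <= 40 * s by nra.
have eps2 : eps <= 2 * s.
  by rewrite /eps ler_pdivrMr //; nra.
split => //; first lra.
have q0 : 0 < dl - 4 * s by lra.
rewrite ler_pdivrMr //.
have d2 : 0 < dl ^+ 2 by rewrite exprn_gt0.
have -> : (D + 28 / dl ^+ 2 * s ^+ 2) * (dl - 4 * s) =
  (D * dl ^+ 2 + 28 * s ^+ 2) * (dl - 4 * s) / dl ^+ 2 by field; rewrite gt_eqF.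
rewrite ler_pdivlMr //.
(* after cancellation: D (eps + 4 s) dl^2 <= 28 s^2 (dl - 4 s) *)
have E1 : (D * dl) * (eps + 4 * s) <= 2 * s * (6 * s).
  by apply: ler_pM; [rewrite mulr_ge0 // ltW|lra|lra|lra].
have E2 : (D * dl) * (eps + 4 * s) * dl <= 2 * s * (6 * s) * dl by rewrite ler_pM2r.
have E3 : 2 * s * (6 * s) * dl <= 28 * s ^+ 2 * (dl - 4 * s).
  rewrite (_ : 2 * s * (6 * s) * dl = s ^+ 2 * (12 * dl)); last by ring.
  rewrite (_ : 28 * s ^+ 2 * _ = s ^+ 2 * (28 * (dl - 4 * s))); last by ring.
  by rewrite ler_wpM2l ?sqr_ge0 //; lra.
have E4 : eps * dl ^+ 2 = D * dl ^+ 2 * (dl - 4 * s) + (D * dl) * (eps + 4 * s) * dl.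
  by rewrite {1}epsE; ring.
rewrite E4 mulrDl; lra.
Qed.

(** Here v is the length of the segments that are replaced: v / (del + v) bounds
    their cost from below, and del - v bounds d from below at their ends. *)
Lemma second_difference_bound (R : realType) (del dl v w e : R) :
  0 < dl -> dl <= del -> 0 < v -> 4 * v <= dl -> 0 <= w -> 0 < e ->
  (2 * v + e * w) / (del - v) <=
    2 * (v / (del + v)) + (2 * e / dl * w + 8 / dl ^+ 2 * v ^+ 2).
Proof.
move=> dl0 dd v0 v4 w0 e0.
have q0 : 0 < del - v by lra.
have p0 : 0 < del + v by lra.
have -> : (2 * v + e * w) / (del - v) = 2 * (v / (del + v)) +
   (e * w / (del - v) + 4 * v ^+ 2 / ((del - v) * (del + v))).
  by field; rewrite !gt_eqF.
rewrite lerD2l; apply: lerD.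
  have -> : 2 * e / dl * w = e * w / (dl / 2) by field; rewrite gt_eqF.
  apply: ler_wpM2l; first by rewrite mulr_ge0 // ltW.
  by rewrite lef_pV2 ?posrE ?divr_gt0 //; lra.
have -> : 8 / dl ^+ 2 * v ^+ 2 = 4 * v ^+ 2 / (dl * (dl / 2)) by field; rewrite gt_eqF.
apply: ler_wpM2l; first by rewrite mulr_ge0 ?sqr_ge0.
rewrite lef_pV2 ?posrE ?mulr_gt0 ?divr_gt0 // [(_ - _) * _]mulrC.
by apply: ler_pM; lra.
Qed.

Section LocalEstimates.
Variables (R : realType) (X : normedModType R) (Omega : set X).
Hypothesis domO : convex_domain Omega.
Implicit Types x y z a b : X.

Let openO : open Omega. Proof. by case: domO. Qed.
Let bdO : boundary Omega !=set0. Proof. by case: domO. Qed.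
Let convO : forall a b (l : R), Omega a -> Omega b -> 0 <= l <= 1 ->
  Omega (l *: a + (1 - l) *: b). Proof. by case: domO. Qed.

Notation d z := (bdist Omega z).
Notation k := (quasihyperbolic Omega).

Lemma qh_le_ball x y (m : R) : Omega x -> Omega y -> 0 < m -> m <= d x -> m <= d y ->
  k x y <= `|x - y| / m.
Proof.
move=> Ox Oy m0 mx my; apply: (le_trans (qh_le_edge domO Ox Oy)); rewrite distrC.
apply: ler_wpM2l => //; rewrite lef_pV2 ?posrE ?le_min ?mx //.
by rewrite lt_min !(bdist_gt0 openO bdO).
Qed.

(** The conditions on the norm of a - b keep the cut point between x and a and
    keep d comparable to d a near a. *)
Lemma qh_semiconvex_le x a b (l dl : R) : Omega x -> Omega a -> Omega b ->
  0 < dl -> dl <= d a -> 40 * `|a - b| <= dl -> 3 * `|a - b| <= `|x - a| ->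
  0 <= l <= 1 -> k x b <= k x a ->
  k x (l *: a + (1 - l) *: b) <=
    l * k x a + (1 - l) * k x b + 28 / dl ^+ 2 * `|a - b| ^+ 2.
Proof.
move=> Ox Oa Ob dl0 dla s40 sx l01 kba; have /andP[l0 l1] := l01.
set s := `|a - b| in s40 sx *; set D := k x a - k x b.
have s0 : 0 <= s by rewrite /s.
have da0 := bdist_gt0 openO bdO Oa.
have dab : d a - s <= d b by exact: set_dist_lipschitz.
have das0 : 0 < d a - s by move: s40 dla dl0 s0; clear; lra.
have D0 : 0 <= D by rewrite subr_ge0.
have Ds : D * (d a - s) <= s.
  rewrite -ler_pdivlMr // /D lerBlDl.
  apply: (le_trans (qh_triangle domO Ox Ob Oa)); rewrite lerD2l.
  have := qh_le_ball Ob Oa das0 dab; rewrite distrC; apply.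
  by rewrite lerBlDr lerDl.
have sda : 40 * s <= d a by exact: le_trans dla.
have := cut_length_bounds da0 s0 sda D0 Ds.
set eps := d a * D / _ => -[eps0 epsE eps3 epsq].
apply/ler_addgt0Pr => e e0.
have [z [Oz za zk]] := qh_cut domO Ox Oa eps0 (le_trans eps3 sx) e0.
have zb : k x z <= k x b + e.
  have de0 : 0 < d a + eps by rewrite ltr_wpDr.
  have := qh_lower domO Oz Oa; rewrite za {1}epsE ler_pM2r //.
  by move: zk; rewrite /D; clear; lra.
have bb : k x b <= k x b + e by rewrite lerDl ltW.
have := qh_quasiconvex domO Ox Oz Ob l01 zb bb.
set c' := l *: z + _; set c := l *: a + _ => kc'.
have Oc : Omega c by exact: convO.
have Oc' : Omega c' by exact: convO.
have cc' : `|c' - c| = l * eps.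
  rewrite /c /c' opprD addrACA subrr addr0 -scalerBr normrZ za ger0_norm //.
have dc : d a - s <= d c.
  apply: le_trans (bdist_concave openO bdO convO Oa Ob l01).
  by move: dab l0 l1 s0 das0; clear; nra.
have dc' : d c - `|c - c'| <= d c' by exact: set_dist_lipschitz.
have leps : l * eps <= eps by rewrite -[leRHS]mul1r ler_wpM2r.
have kcc : k c' c <= (l * eps) / (d a - 4 * s).
  rewrite -cc'; apply: qh_le_ball => //.
  - by move: sda da0 s0; clear; lra.
  - by move: dc' dc leps eps3; rewrite distrC cc'; clear; lra.
  - by move: dc s0; clear; lra.
apply: (le_trans (qh_triangle domO Ox Oc' Oc)).
have h1 : (l * eps) / (d a - 4 * s) <= l * D + 28 / dl ^+ 2 * s ^+ 2.
  rewrite -mulrA; apply: (@le_trans _ _ (l * (D + 28 / d a ^+ 2 * s ^+ 2))).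
    exact: ler_wpM2l.
  rewrite mulrDr lerD2l.
  have p0 : 0 <= 28 / d a ^+ 2 * s ^+ 2 by rewrite !mulr_ge0 ?invr_ge0 ?sqr_ge0.
  apply: (@le_trans _ _ (28 / d a ^+ 2 * s ^+ 2)); first by rewrite -[leRHS]mul1r ler_wpM2r.
  rewrite ler_wpM2r ?sqr_ge0 // ler_pM2l // lef_pV2 ?posrE ?exprn_gt0 //.
  by rewrite ler_pXn2r ?nnegrE // ltW.
have -> : l * k x a + (1 - l) * k x b = k x b + l * D by rewrite /D; ring.
by move: kc' kcc h1; clear; lra.
Qed.

Lemma qh_semiconvex x a b (l dl : R) : Omega x -> Omega a -> Omega b ->
  0 < dl -> dl <= d a -> dl <= d b -> 40 * `|a - b| <= dl ->
  3 * `|a - b| <= `|x - a| -> 3 * `|a - b| <= `|x - b| -> 0 <= l <= 1 ->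
  k x (l *: a + (1 - l) *: b) <=
    l * k x a + (1 - l) * k x b + 28 / dl ^+ 2 * `|a - b| ^+ 2.
Proof.
move=> Ox Oa Ob dl0 dla dlb s40 sa sb l01.
have [kba|/ltW kab] := leP (k x b) (k x a); first exact: qh_semiconvex_le.
have l01' : 0 <= 1 - l <= 1 by move: l01 => /andP[? ?]; apply/andP; split; lra.
have E : 1 - (1 - l) = l by rewrite opprB addrC subrK.
rewrite distrC in s40 sa sb *.
have := qh_semiconvex_le Ox Ob Oa dl0 dlb s40 sb l01' kab.
by rewrite E [(1 - l) *: b + _]addrC [(1 - l) * _ + _]addrC.
Qed.

Lemma qh_second_difference x y h (e tau dl : R) : Omega x -> Omega y -> h != 0 ->
  (forall v g : X, `|g| <= tau * `|v| -> `|v + g| + `|v - g| <= 2 * `|v| + e * `|g|) ->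
  0 < e -> 0 < tau <= 1 -> 0 < dl -> dl <= d y ->
  4 * `|h| <= tau * dl -> `|h| <= tau * `|x - y| ->
  k x (y + h) + k x (y - h) - 2 * k x y <=
    (2 * e / dl + 8 / (tau ^+ 2 * dl ^+ 2) * `|h|) * `|h|.
Proof.
move=> Ox Oy hn0 sm e0 /andP[t0 t1] dl0 dly h4 hx.
have hn : 0 < `|h| by rewrite normr_gt0.
pose v := `|h| / tau.
have v0 : 0 < v by rewrite divr_gt0.
have vt : tau * v = `|h| by rewrite mulrC divfK // gt_eqF.
have hv : `|h| <= v by rewrite -vt -[leRHS]mul1r ler_wpM2r // ltW.
have vx : v <= `|x - y| by rewrite ler_pdivrMr // mulrC.
have v4 : 4 * v <= dl by rewrite /v mulrA ler_pdivrMr // [dl * _]mulrC.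
have v4' : 4 * v <= d y by exact: le_trans dly.
have q0 : 0 < d y - v by move: v4' v0; clear; lra.
have Ohy g : `|g| = `|h| -> Omega (y + g) /\ d y - v <= d (y + g).
  move=> gh; have E : `|y - (y + g)| = `|h| by rewrite opprD addrA subrr sub0r normrN.
  split; last by have := set_dist_lipschitz y (y + g) bdO; rewrite E; move: hv; clear; lra.
  by apply: (ball_bdist_sub openO Oy); rewrite E; move: hv v4' v0; clear; lra.
have [yhO d1] := Ohy h erefl.
have [yhO' d2] := Ohy (- h) (normrN h).
apply/ler_addgt0Pr => et et0.
have et20 : 0 < et / 2 by rewrite divr_gt0.
have [z [Oz zy zk]] := qh_cut domO Ox Oy (ltW v0) vx et20.
have dz : d y - v <= d z.
  by have := set_dist_lipschitz y z bdO; rewrite distrC zy; clear; lra.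
have b1 := qh_le_ball Oz yhO q0 dz d1.
have b2 := qh_le_ball Oz yhO' q0 dz d2.
have t1' := qh_triangle domO Ox Oz yhO.
have t2' := qh_triangle domO Ox Oz yhO'.
have low : v / (d y + v) <= k z y.
  have p0 : 0 < d y + v by move: q0 v0; clear; lra.
  by rewrite ler_pdivrMr // -zy; exact: qh_lower.
have hzy : `|h| <= tau * `|z - y| by rewrite zy vt.
have := sm _ _ hzy; rewrite zy => PQ.
have E1 : z - (y + h) = z - y - h by rewrite opprD addrA.
have E2 : z - (y - h) = z - y + h by rewrite opprB addrA addrAC.
rewrite E1 in b1; rewrite E2 in b2.
have up : `|z - y - h| / (d y - v) + `|z - y + h| / (d y - v) <=
    (2 * v + e * `|h|) / (d y - v).
  rewrite -mulrDl; apply: ler_wpM2r; first by rewrite invr_ge0 ltW.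
  by rewrite [leLHS]addrC.
have := second_difference_bound dl0 dly v0 v4 (ltW hn) e0.
have -> : (2 * e / dl + 8 / (tau ^+ 2 * dl ^+ 2) * `|h|) * `|h| =
    2 * e / dl * `|h| + 8 / dl ^+ 2 * v ^+ 2.
  by rewrite /v; field; rewrite !gt_eqF.
by move: zk b1 b2 t1' t2' low up; clear; lra.
Qed.
End LocalEstimates.

(** * Semiconvexity and smoothness imply continuous differentiability *)

Lemma differentiable_of_estimate (R : realType) (X : normedModType R) (f : X -> R)
    (y : X) (L : X -> R) (C : R) :
  (forall (c : R) u v, L (c *: u + v) = c * L u + L v) ->
  (forall h, `|L h| <= C * `|h|) ->
  (forall eta : R, 0 < eta -> exists2 rho, 0 < rho & forall h, `|h| < rho ->
     `|f (y + h) - f y - L h| <= eta * `|h|) ->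
  differentiable f y /\ forall h, 'd f y h = L h.
Proof.
move=> linL bL est.
pose l : {linear X -> R} := HB.pack L (GRing.isLinear.Build R X R _ L linL).
have cl : continuous l.
  apply: continuousfor0_continuous; apply/cvgrPdist_lt => e e0.
  have C0 : 0 < `|C| + 1 by rewrite ltr_wpDl.
  apply/nbhs_ballP; exists (e / (`|C| + 1)) => /=; first by rewrite divr_gt0.
  move=> h; rewrite -ball_normE /= sub0r normrN ltr_pdivlMr // mulrC => hlt.
  have L0 : L 0 = 0 by exact: (linear0 l).
  change (`|L 0 - L h| < e); rewrite L0 sub0r normrN; apply: le_lt_trans hlt; apply: (le_trans (bL h)).
  by apply: ler_wpM2r => //; apply: (le_trans (ler_norm _)); rewrite lerDl.
have lo : f \o shift y = cst (f y) + l +o_ 0 id.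
  apply/eqaddoP => e e0; have [rho rho0 H] := est e e0.
  apply/nbhs_ballP; exists rho => //= h; rewrite -ball_normE /= sub0r normrN => /H.
  suff -> : (f \o shift y - (cst (f y) + l)) h = f (y + h) - f y - L h by [].
  change (f (h + y) - (f y + L h) = f (y + h) - f y - L h).
  by rewrite [h + y]addrC opprD addrA.
have E := diff_unique cl lo.
split; last by move=> h; rewrite E.
by apply/diff_locallyP; rewrite E.
Qed.

Section Calculus.
Variables (R : realType) (X : normedModType R) (f : X -> R) (y0 : X) (r C : R).
Hypotheses (r0 : 0 < r) (C0 : 0 <= C).
Hypothesis lip : forall a b, `|y0 - a| < r -> `|y0 - b| < r ->
  `|f a - f b| <= C * `|a - b|.
Hypothesis semiconvex : forall a b (l : R), `|y0 - a| < r -> `|y0 - b| < r ->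
  0 <= l <= 1 -> f (l *: a + (1 - l) *: b) <= l * f a + (1 - l) * f b + C * `|a - b| ^+ 2.
Hypothesis smooth : forall e : R, 0 < e -> exists2 t0 : R, 0 < t0 &
  forall y h, `|y0 - y| < r -> `|h| < t0 -> f (y + h) + f (y - h) - 2 * f y <= e * `|h|.

Definition quotient y (t : R) h := (f (y + t *: h) - f y) / t.

Lemma half_ball y h : `|y0 - y| < r / 2 -> `|h| < r / 2 -> `|y0 - (y + h)| < r.
Proof.
move=> hy hh; rewrite opprD addrA; apply: (le_lt_trans (ler_normB _ _)).
by rewrite [ltRHS]splitr; exact: ltrD.
Qed.

Lemma half_ball0 y : `|y0 - y| < r / 2 -> `|y0 - y| < r.
Proof. by move=> /lt_le_trans; apply; rewrite ler_pdivrMr // ler_pMr // ler1n. Qed.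

Lemma scale_norm (t : R) (h : X) : 0 < t -> `|t *: h| = t * `|h|.
Proof. by move=> t0; rewrite normrZ gtr0_norm. Qed.

(** Semiconvexity between y + t h and y; the error is acceptable only when s is
    comparable to t. *)
Lemma quotient_le y h (s t : R) : `|y0 - y| < r / 2 -> 0 < s -> s <= t ->
  t * `|h| < r / 2 -> quotient y s h <= quotient y t h + C * t ^+ 2 * `|h| ^+ 2 / s.
Proof.
move=> hy s0 st th; have t0 := lt_le_trans s0 st.
have By : `|y0 - y| < r by exact: half_ball0.
have Bt : `|y0 - (y + t *: h)| < r by apply: half_ball => //; rewrite scale_norm.
have l01 : 0 <= s / t <= 1.
  by apply/andP; split; [rewrite divr_ge0 // ltW|rewrite ler_pdivrMr // mul1r].
have := semiconvex Bt By l01.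
have -> : (s / t) *: (y + t *: h) + (1 - s / t) *: y = y + s *: h.
  rewrite scalerDr scalerA divfK ?gt_eqF // addrAC -scalerDl [_ + (1 - _)]addrC subrK.
  by rewrite scale1r.
have -> : y + t *: h - y = t *: h by rewrite addrC addKr.
rewrite scale_norm // => H.
rewrite /quotient ler_pdivrMr // mulrDl divfK ?gt_eqF //.
have -> : (f (y + t *: h) - f y) / t * s = s / t * f (y + t *: h) - s / t * f y.
  by field; rewrite gt_eqF.
by move: H; rewrite exprMn; lra.
Qed.

(** Passing from t to s by successive halving keeps the errors summable. *)
Lemma quotient_le_dyadic y h n (s t : R) : `|y0 - y| < r / 2 -> 0 < s -> s <= t ->
  t <= s * 2 ^+ n -> t * `|h| < r / 2 -> quotient y s h <= quotient y t h + 4 * C * t * `|h| ^+ 2.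
Proof.
move=> hy; elim: n s t => [|n IH] s t s0 st.
  rewrite expr0 mulr1 => ts th; have -> : s = t by apply/eqP; rewrite eq_le st.
  have t0 := lt_le_trans s0 st.
  by rewrite lerDl !mulr_ge0 ?sqr_ge0 // ltW.
move=> tsn th; have t0 := lt_le_trans s0 st.
have P0 : 0 <= C * t * `|h| ^+ 2 by rewrite !mulr_ge0 ?sqr_ge0 // ltW.
have main u : t / 2 <= u -> u <= t -> quotient y u h <= quotient y t h + 2 * C * t * `|h| ^+ 2.
  move=> tu ut; have u0 : 0 < u by apply: lt_le_trans tu; rewrite divr_gt0.
  apply: (le_trans (quotient_le hy u0 ut th)); rewrite lerD2l ler_pdivrMr //.
  have -> : C * t ^+ 2 * `|h| ^+ 2 = (C * t * `|h| ^+ 2) * t by ring.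
  have -> : 2 * C * t * `|h| ^+ 2 * u = (C * t * `|h| ^+ 2) * (2 * u) by ring.
  by apply: ler_wpM2l => //; move: tu; lra.
have [ts|/ltW ts] := leP (t / 2) s.
  by apply: (le_trans (main s ts st)); move: P0; lra.
have h1 := main (t / 2) (lexx _) ltac:(by rewrite ler_pdivrMr // ler_pMr // ler1n).
have h2 : quotient y s h <= quotient y (t / 2) h + 4 * C * (t / 2) * `|h| ^+ 2.
  apply: IH => //; first by rewrite ler_pdivrMr // -mulrA -exprSr.
  apply: le_lt_trans th; apply: ler_wpM2r => //.
  by rewrite ler_pdivrMr // ler_pMr // ler1n.
by move: h1 h2; lra.
Qed.

Lemma quotient_monotone y h (s t : R) : `|y0 - y| < r / 2 -> 0 < s -> s <= t ->
  t * `|h| < r / 2 -> quotient y s h <= quotient y t h + 4 * C * t * `|h| ^+ 2.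
Proof.
move=> hy s0 st th; have t0 := lt_le_trans s0 st.
apply: (quotient_le_dyadic (n := Num.Def.archi_bound (t / s))) => //.
rewrite mulrC -ler_pdivrMr //; apply: ltW.
have ts0 : 0 <= t / s by rewrite divr_ge0 // ltW.
apply: (lt_trans (archi_boundP ts0)).
by rewrite -natrX ltr_nat; apply: ltn_expl.
Qed.

Lemma quotient_opp_ge y h (t : R) : `|y0 - y| < r / 2 -> 0 < t -> t * `|h| < r / 2 ->
  - (8 * C * t * `|h| ^+ 2) <= quotient y t h + quotient y t (- h).
Proof.
move=> hy t0 th.
have Bp : `|y0 - (y + t *: h)| < r by apply: half_ball => //; rewrite scale_norm.
have Bm : `|y0 - (y + t *: - h)| < r by apply: half_ball => //; rewrite scale_norm // normrN.
have l01 : 0 <= (2^-1 : R) <= 1 by apply/andP; split; lra.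
have := semiconvex Bp Bm l01.
have -> : 2^-1 *: (y + t *: h) + (1 - 2^-1) *: (y + t *: - h) = y.
  have -> : 1 - 2^-1 = 2^-1 :> R by lra.
  rewrite -scalerDr addrACA -scalerDr subrr scaler0 addr0 scalerDr -scalerDl.
  by rewrite (_ : 2^-1 + 2^-1 = 1 :> R) ?scale1r //; lra.
have -> : `|y + t *: h - (y + t *: - h)| = 2 * (t * `|h|).
  rewrite opprD addrACA subrr add0r scalerN opprK -mulr2n -scaler_nat normrZ scale_norm //.
  by rewrite ger0_norm.
move=> H; rewrite /quotient -mulrDl ler_pdivlMr //.
by move: H; rewrite !exprMn !expr2; lra.
Qed.

Lemma quotient_opp_le (e : R) : 0 < e -> exists2 t0 : R, 0 < t0 & forall y h (t : R),
  `|y0 - y| < r / 2 -> 0 < t -> t * `|h| < t0 -> quotient y t h + quotient y t (- h) <= e * `|h|.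
Proof.
move=> e0; have [t0 t00 H] := smooth e0; exists t0 => // y h t hy tp th.
rewrite -scale_norm // in th.
have := H y (t *: h) (half_ball0 hy) th.
rewrite scale_norm // /quotient -mulrDl ler_pdivrMr // scalerN.
by lra.
Qed.

Lemma quotient_lip y h (t : R) : `|y0 - y| < r / 2 -> 0 < t -> t * `|h| < r / 2 ->
  `|quotient y t h| <= C * `|h|.
Proof.
move=> hy t0 th.
have By : `|y0 - y| < r by exact: half_ball0.
have Bt : `|y0 - (y + t *: h)| < r by apply: half_ball => //; rewrite scale_norm.
have := lip Bt By.
have -> : y + t *: h - y = t *: h by rewrite addrC addKr.
by rewrite scale_norm // /quotient normrM normfV (gtr0_norm t0) ler_pdivrMr // mulrAC mulrA.
Qed.

(** The limit of the quotients as t tends to 0, written as an infimum: the added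
    term compensates the defect of monotonicity. *)
Definition slope y h := inf [set quotient y t h + 4 * C * t * `|h| ^+ 2 | t in
  [set t : R | 0 < t /\ t * `|h| < r / 2]].

(** The quotient at a smaller step u is at most the one at t, up to O(t); in the
    direction - h it is likewise at most the one at t, and as opposite quotients
    nearly cancel this bounds the quotient at u from below. *)
Lemma quotient_approx (eta : R) : 0 < eta -> exists2 rho : R, 0 < rho /\ rho <= r / 2 &
  forall y h (t : R), `|y0 - y| < r / 2 -> 0 < t -> t * `|h| < rho ->
  `|quotient y t h - slope y h| <= eta * `|h|.
Proof.
move=> eta0; have eta20 : 0 < eta / 2 by rewrite divr_gt0.
have [t0 t00 H] := quotient_opp_le eta20.
have C1 : 0 < 12 * C + 1 by rewrite ltr_wpDl // mulr_ge0.
pose rho := Num.min (Num.min t0 (r / 2)) (eta / 2 / (12 * C + 1)).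
have rho0 : 0 < rho by rewrite !lt_min t00 !divr_gt0.
have rhor : rho <= r / 2 by rewrite !ge_min lexx orbT.
exists rho => // y h t hy tp tr.
have th : t * `|h| < r / 2 by exact: lt_le_trans rhor.
have tt0 : t * `|h| < t0 by apply: (lt_le_trans tr); rewrite !ge_min lexx.
have small : 12 * C * t * `|h| ^+ 2 <= eta / 2 * `|h|.
  have : t * `|h| * (12 * C + 1) <= eta / 2.
    rewrite -ler_pdivlMr //; apply: ltW; apply: (lt_le_trans tr).
    by rewrite !ge_min lexx !orbT.
  move=> h1; rewrite expr2 !mulrA; apply: ler_wpM2r => //.
  apply: le_trans h1; rewrite -mulrA mulrC; apply: ler_wpM2l; first by rewrite mulr_ge0 // ltW.
  by rewrite lerDl.
have Ct0 (u : R) : 0 < u -> 0 <= C * u * `|h| ^+ 2.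
  by move=> u0; rewrite !mulr_ge0 ?sqr_ge0 // ltW.
have lower (u : R) : 0 < u -> u * `|h| < r / 2 ->
    quotient y t h - eta * `|h| <= quotient y u h + 4 * C * u * `|h| ^+ 2.
  move=> u0 uh; have [tu|/ltW ut] := leP t u.
    have := quotient_monotone hy tp tu uh.
    by have := mulr_ge0 (ltW eta0) (normr_ge0 h); lra.
  have g1 := quotient_opp_ge hy u0 uh.
  have th' : t * `|- h| < r / 2 by rewrite normrN.
  have g2 := quotient_monotone hy u0 ut th'.
  have g3 := H y h t hy tp tt0.
  have g4 : C * u * `|h| ^+ 2 <= C * t * `|h| ^+ 2.
    by rewrite ler_wpM2r ?sqr_ge0 // ler_wpM2l.
  rewrite normrN in g2.
  by move: g1 g2 g3 g4 small (Ct0 u u0) (Ct0 t tp); lra.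
have Lle : slope y h <= quotient y t h + 4 * C * t * `|h| ^+ 2.
  apply: ge_inf; last by exists t.
  by exists (quotient y t h - eta * `|h|) => _ [u [u0 uh] <-]; exact: lower.
have Lge : quotient y t h - eta * `|h| <= slope y h.
  apply: lb_le_inf; first by exists (quotient y t h + 4 * C * t * `|h| ^+ 2), t.
  by move=> _ [u [u0 uh] <-]; exact: lower.
have := mulr_ge0 (ltW eta0) (normr_ge0 h).
move: (Ct0 t tp) small Lle Lge; rewrite ler_norml; move=> *; apply/andP; split; lra.
Qed.

Lemma quotient_cvg y h : `|y0 - y| < r / 2 -> quotient y t h @[t --> 0^'+] --> slope y h.
Proof.
move=> hy; apply/cvgrPdist_le => e e0.
have h1 : 0 < `|h| + 1 by rewrite ltr_wpDl.
have [rho [rho0 rhor] H] := quotient_approx (divr_gt0 e0 h1).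
near=> t; rewrite distrC.
have t0 : 0 < t by near: t; exact: nbhs_right_gt.
have th : t * `|h| < rho.
  have : t * (`|h| + 1) < rho.
    by rewrite -ltr_pdivlMr //; near: t; apply: nbhs_right_lt; rewrite divr_gt0.
  by apply: le_lt_trans; rewrite ler_pM2l // lerDl.
apply: (le_trans (H y h t hy t0 th)).
by rewrite mulrAC ler_pdivrMr // ler_pM2l // lerDl.
Unshelve. all: by end_near. Qed.

Lemma near_small_scale (h : X) (rho : R) : 0 < rho ->
  \forall t \near (0 : R)^'+, 0 < t /\ t * `|h| < rho.
Proof.
move=> rho0; have h1 : 0 < `|h| + 1 by rewrite ltr_wpDl.
near=> t; have t0 : 0 < t by near: t; exact: nbhs_right_gt.
split=> //; have : t * (`|h| + 1) < rho.
  by rewrite -ltr_pdivlMr //; near: t; apply: nbhs_right_lt; rewrite divr_gt0.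
by apply: le_lt_trans; rewrite ler_pM2l // lerDl.
Unshelve. all: by end_near. Qed.

Lemma slope_bound y h : `|y0 - y| < r / 2 -> `|slope y h| <= C * `|h|.
Proof.
move=> hy; have r20 : 0 < r / 2 by rewrite divr_gt0.
rewrite -subr_ge0; apply: (@cvgr_to_ge _ (0 : R)^'+ _ _ (fun t => C * `|h| - `|quotient y t h|)).
  by apply: cvgB; [exact: cvg_cst|apply: cvg_norm; exact: quotient_cvg].
near=> t; rewrite subr_ge0; have [t0 th] : 0 < t /\ t * `|h| < r / 2.
  by near: t; exact: near_small_scale.
exact: quotient_lip.
Unshelve. all: by end_near. Qed.

Lemma cvg_right0_scale (K : R) : (fun t : R => t * K) @ (0 : R)^'+ --> (0 : R).
Proof.
have {2}-> : 0 = 0 * K by rewrite mul0r.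
by apply: cvgM; [apply: cvg_at_right_filter; exact: cvg_id|exact: cvg_cst].
Qed.

Lemma slope_opp y h : `|y0 - y| < r / 2 -> slope y (- h) = - slope y h.
Proof.
move=> hy; have r20 : 0 < r / 2 by rewrite divr_gt0.
have cv : (fun t => quotient y t h + quotient y t (- h)) @ (0 : R)^'+ --> slope y h + slope y (- h).
  by apply: cvgD; exact: quotient_cvg.
have ge0 : 0 <= slope y h + slope y (- h).
  rewrite -[leRHS]addr0.
  apply: (@cvgr_to_ge _ (0 : R)^'+ _ _
      (fun t => quotient y t h + quotient y t (- h) + t * (8 * C * `|h| ^+ 2))).
    by apply: cvgD; [exact: cv|exact: cvg_right0_scale].
  near=> t; have [t0 th] : 0 < t /\ t * `|h| < r / 2 by near: t; exact: near_small_scale.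
  by have := quotient_opp_ge hy t0 th; lra.
have le0 : slope y h + slope y (- h) <= 0.
  apply/ler_addgt0Pr => e e0; rewrite add0r.
  have h1 : 0 < `|h| + 1 by rewrite ltr_wpDl.
  have [t0 t00 H] := quotient_opp_le (divr_gt0 e0 h1).
  rewrite -subr_ge0.
  apply: (@cvgr_to_ge _ (0 : R)^'+ _ _ (fun t => e - (quotient y t h + quotient y t (- h)))).
    by apply: cvgB; [exact: cvg_cst|exact: cv].
  near=> t; have [tp th] : 0 < t /\ t * `|h| < t0 by near: t; exact: near_small_scale.
  rewrite subr_ge0; apply: (le_trans (H y h t hy tp th)).
  by rewrite mulrAC ler_pdivrMr // ler_pM2l // lerDl.
by apply/eqP; rewrite -addr_eq0 addrC eq_le le0.
Unshelve. all: by end_near. Qed.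

Lemma slope_convex y u v (l : R) : `|y0 - y| < r / 2 -> 0 <= l <= 1 ->
  slope y (l *: u + (1 - l) *: v) <= l * slope y u + (1 - l) * slope y v.
Proof.
move=> hy l01; have r20 : 0 < r / 2 by rewrite divr_gt0.
rewrite -subr_ge0 -[l * _ + _]addr0.
apply: (@cvgr_to_ge _ (0 : R)^'+ _ _ (fun t =>
   l * quotient y t u + (1 - l) * quotient y t v + t * (C * `|u - v| ^+ 2) -
   quotient y t (l *: u + (1 - l) *: v))).
  apply: cvgB; last exact: quotient_cvg.
  apply: cvgD; last exact: cvg_right0_scale.
  by apply: cvgD; (apply: cvgM; [exact: cvg_cst|exact: quotient_cvg]).
near=> t; have [t0 tu] : 0 < t /\ t * `|u| < r / 2 by near: t; exact: near_small_scale.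
have [_ tv] : 0 < t /\ t * `|v| < r / 2 by near: t; exact: near_small_scale.
have Bu : `|y0 - (y + t *: u)| < r by apply: half_ball => //; rewrite scale_norm.
have Bv : `|y0 - (y + t *: v)| < r by apply: half_ball => //; rewrite scale_norm.
have := semiconvex Bu Bv l01.
have -> : l *: (y + t *: u) + (1 - l) *: (y + t *: v) = y + t *: (l *: u + (1 - l) *: v).
  rewrite !scalerDr addrACA -scalerDl [l + _]addrC subrK scale1r !scalerA.
  by rewrite [l * t]mulrC [(1 - l) * t]mulrC.
have -> : y + t *: u - (y + t *: v) = t *: (u - v).
  by rewrite opprD addrACA subrr add0r scalerBr.
rewrite scale_norm // => H; rewrite subr_ge0 /quotient ler_pdivrMr //.
have -> : (l * ((f (y + t *: u) - f y) / t) + (1 - l) * ((f (y + t *: v) - f y) / t) +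
   t * (C * `|u - v| ^+ 2)) * t = l * f (y + t *: u) + (1 - l) * f (y + t *: v) +
   C * (t * `|u - v|) ^+ 2 - f y by field; rewrite gt_eqF.
by rewrite lerD2r.
Unshelve. all: by end_near. Qed.

Lemma slope0 y : `|y0 - y| < r / 2 -> slope y 0 = 0.
Proof. by move=> /(slope_bound 0); rewrite normr0 mulr0 normr_le0 => /eqP. Qed.

(** Convexity compares the slope at l u with the one at u on one side, and
    oddness gives the other. *)
Lemma slope_scale01 y u (l : R) : `|y0 - y| < r / 2 -> 0 <= l <= 1 -> slope y (l *: u) = l * slope y u.
Proof.
move=> hy l01; have le v : slope y (l *: v) <= l * slope y v.
  by have := slope_convex v 0 hy l01; rewrite slope0 // mulr0 addr0 scaler0 addr0.
apply/eqP; rewrite eq_le le /=; have := le (- u).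
by rewrite scalerN !slope_opp // mulrN lerN2.
Qed.

Lemma slope_scale y u (c : R) : `|y0 - y| < r / 2 -> slope y (c *: u) = c * slope y u.
Proof.
move=> hy; have pos (a : R) v : 0 <= a -> slope y (a *: v) = a * slope y v.
  move=> a0; have [a1|/ltW a1] := leP a 1; first by apply: slope_scale01; rewrite ?a0.
  have ap : 0 < a by exact: lt_le_trans a1.
  have l01 : 0 <= a^-1 <= 1 by rewrite invr_ge0 a0 invf_le1.
  have := slope_scale01 (a *: v) hy l01; rewrite scalerA mulVf ?gt_eqF // scale1r => ->.
  by rewrite mulrA mulfV ?gt_eqF // mul1r.
have [c0|/ltW c0] := leP 0 c; first exact: pos.
by rewrite -[c]opprK scaleNr slope_opp // pos ?oppr_ge0 // !mulNr.
Qed.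

Lemma slope_add y u v : `|y0 - y| < r / 2 -> slope y (u + v) = slope y u + slope y v.
Proof.
move=> hy; have l01 : 0 <= (2^-1 : R) <= 1 by apply/andP; split; lra.
have le a b : slope y (a + b) <= slope y a + slope y b.
  have := slope_convex a b hy l01; have -> : 1 - 2^-1 = 2^-1 :> R by lra.
  by rewrite -scalerDr slope_scale // -mulrDr ler_pM2l // invr_gt0.
apply/eqP; rewrite eq_le le /=; have := le (- u) (- v).
by rewrite -opprD !slope_opp // -opprD lerN2.
Qed.

Lemma differentiable_half_ball y : `|y0 - y| < r / 2 ->
  differentiable f y /\ forall h, 'd f y h = slope y h.
Proof.
move=> hy; apply: (@differentiable_of_estimate _ _ _ _ _ C).
- by move=> c u v; rewrite slope_add // slope_scale.
- by move=> h; exact: slope_bound.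
move=> eta eta0; have [rho [rho0 _] H] := quotient_approx eta0; exists rho => // h hr.
by have := H y h 1 hy ltr01; rewrite /quotient mul1r scale1r divr1; apply.
Qed.

(** At a fixed small step the quotients depend continuously on the base point,
    and they approximate the slopes uniformly. *)
Lemma C1_at : differentiable f y0 /\
  operator_norm (fun h => 'd f y h - 'd f y0 h) @[y --> nbhs y0] --> (0 : R).
Proof.
have r20 : 0 < r / 2 by rewrite divr_gt0.
have h00 : `|y0 - y0| < r / 2 by rewrite subrr normr0.
have [df0 D0] := differentiable_half_ball h00; split=> //.
apply/cvgrPdist_le => e e0; have e40 : 0 < e / 4 by rewrite divr_gt0.
have [rho [rho0 rhor] H] := quotient_approx e40.
pose t := rho / 2; have t0 : 0 < t by rewrite divr_gt0.
have tr : t < rho by rewrite ltr_pdivrMr // ltr_pMr // ltr1n.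
pose del := Num.min (r / 2) (e * t / (4 * (C + 1))).
have C1 : 0 < 4 * (C + 1) by have := C0; lra.
have del0 : 0 < del by rewrite lt_min r20 divr_gt0 // mulr_gt0.
apply/nbhs_ballP; exists del => //= y; rewrite -ball_normE /= => yd.
have hy : `|y0 - y| < r / 2 by apply: (lt_le_trans yd); rewrite ge_min lexx.
have yC : `|y0 - y| * (4 * (C + 1)) <= e * t.
  by rewrite -ler_pdivlMr //; apply: ltW; apply: (lt_le_trans yd); rewrite ge_min lexx orbT.
have [_ Dy] := differentiable_half_ball hy.
have bnd h : `|h| <= 1 -> `|'d f y h - 'd f y0 h| <= e.
  move=> h1; rewrite Dy D0.
  have tht : t * `|h| <= t by rewrite -[leRHS]mulr1 ler_pM2l.
  have th : t * `|h| < rho by exact: le_lt_trans tr.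
  have th2 : `|t *: h| < r / 2 by rewrite scale_norm //; exact: lt_le_trans rhor.
  have A1 := H y h t hy t0 th; have A2 := H y0 h t h00 t0 th.
  have e4h : e / 4 * `|h| <= e / 4 by rewrite -[leRHS]mulr1 ler_pM2l.
  have A3 : `|quotient y t h - quotient y0 t h| <= e / 2.
    have B1 := lip (half_ball hy th2) (half_ball h00 th2).
    have B2 := lip (half_ball0 hy) (half_ball0 h00).
    rewrite /quotient -mulrBl normrM normfV (gtr0_norm t0) ler_pdivrMr //.
    have -> : f (y + t *: h) - f y - (f (y0 + t *: h) - f y0) =
      (f (y + t *: h) - f (y0 + t *: h)) - (f y - f y0) by ring.
    apply: (le_trans (ler_normB _ _)).
    have E : y + t *: h - (y0 + t *: h) = y - y0 by rewrite opprD addrACA subrr addr0.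
    rewrite E in B1; rewrite distrC in yC.
    have := normr_ge0 (y - y0); move: B1 B2 yC.
    by move: `|f _ - _| `|f _ - _| `|y - y0| => n1 n2 n3; lra.
  have -> : slope y h - slope y0 h = - (quotient y t h - slope y h) + (quotient y t h - quotient y0 t h) +
    (quotient y0 t h - slope y0 h) by ring.
  apply: (le_trans (ler_normD _ _)); apply: (le_trans (lerD (ler_normD _ _) (lexx _))).
  by rewrite normrN; lra.
rewrite sub0r normrN /operator_norm ger0_norm.
  apply: ge_sup; first by exists `|'d f y 0 - 'd f y0 0|, 0 => //=; rewrite normr0.
  by move=> _ [h /= h1 <-]; exact: bnd.
apply: (le_trans (normr_ge0 ('d f y 0 - 'd f y0 0))).
apply: ub_le_sup; first by exists e => _ [h /= h1 <-]; exact: bnd.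
by exists 0 => //=; rewrite normr0.
Qed.
End Calculus.

(** * The quasihyperbolic metric of a convex domain *)

Lemma convex_domainP (R : realType) (X : normedModType R) (Omega : set X) :
  domain Omega -> convex_set Omega -> convex_domain Omega.
Proof.
move=> [openO _ bdO] cO; split => // a b l Oa Ob /andP[l0 l1].
by have := cO a b (Itv01 l0 l1) (mem_set Oa) (mem_set Ob); rewrite inE.
Qed.

(** All constants are tied to one radius, small against both the distance from
    y0 to the boundary and the distance from y0 to the pole x0, where f has a
    conical singularity. *)
Lemma qh_C1_at (R : realType) (X : normedModType R) (Omega : set X) (x0 y0 : X) :
  convex_domain Omega -> Omega x0 -> Omega y0 -> y0 <> x0 -> uniformly_smooth X ->
  differentiable (quasihyperbolic Omega x0) y0 /\
  operator_norm (fun h => 'd (quasihyperbolic Omega x0) y h -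
     'd (quasihyperbolic Omega x0) y0 h) @[y --> nbhs y0] --> (0 : R).
Proof.
move=> domO Ox0 Oy0 xy US; have [openO bdO _] := domO.
have d00 : 0 < bdist Omega y0 by exact: bdist_gt0.
have R00 : 0 < `|x0 - y0| by rewrite normr_gt0 subr_eq0; apply/eqP => /esym.
pose r := Num.min (bdist Omega y0) `|x0 - y0| / 200.
have r0 : 0 < r by rewrite divr_gt0 // lt_min d00.
have [rd rR] : 200 * r <= bdist Omega y0 /\ 200 * r <= `|x0 - y0|.
  by rewrite /r mulrC divfK // !ge_min !lexx orbT.
clearbody r; pose dl := bdist Omega y0 / 2.
have dl0 : 0 < dl by rewrite divr_gt0.
have dlE : bdist Omega y0 = 2 * dl by rewrite /dl mulrC divfK.
clearbody dl.
have nbr y : `|y0 - y| < r ->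
    [/\ Omega y, dl <= bdist Omega y & 199 * r <= `|x0 - y|].
  move=> hy; split.
  - by apply: (ball_bdist_sub openO Oy0); lra.
  - by have := set_dist_lipschitz y0 y bdO; lra.
  have := ler_distD y x0 y0; rewrite [`|y - y0|]distrC; lra.
have pairs a b : `|y0 - a| < r -> `|y0 - b| < r -> `|a - b| < 2 * r.
  move=> ha hb; have := ler_distD y0 a b; rewrite [`|a - y0|]distrC; lra.
pose C := dl^-1 + 28 / dl ^+ 2.
have Ca : 0 < dl^-1 by rewrite invr_gt0.
have Cb : 0 < 28 / dl ^+ 2 by rewrite divr_gt0 // exprn_gt0.
apply: (@C1_at _ _ _ _ r C) => //.
- by rewrite /C addr_ge0 // ltW.
- have half a b : `|y0 - a| < r -> `|y0 - b| < r ->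
    quasihyperbolic Omega x0 a - quasihyperbolic Omega x0 b <= C * `|a - b|.
    move=> ha hb; have [Oa da _] := nbr _ ha; have [Ob db _] := nbr _ hb.
    rewrite lerBlDl; apply: (le_trans (qh_triangle domO Ox0 Ob Oa)); rewrite lerD2l.
    apply: (le_trans (qh_le_ball domO Ob Oa dl0 db da)).
    rewrite distrC mulrC ler_wpM2r // /C lerDl ltW //.
  move=> a b ha hb; rewrite ler_norml lerNl opprB half // andbT.
  by rewrite distrC half.
- move=> a b l ha hb l01.
  have [Oa da xa] := nbr _ ha; have [Ob db xb] := nbr _ hb.
  have ab := pairs _ _ ha hb.
  have := @qh_semiconvex _ _ _ domO x0 a b l dl Ox0 Oa Ob dl0 da db.
  move=> /(_ ltac:(lra) ltac:(lra) ltac:(lra) l01) /le_trans; apply.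
  by rewrite lerD2l ler_wpM2r ?sqr_ge0 // /C lerDr ltW.
move=> e e0.
have e'0 : 0 < e * dl / 4 by rewrite divr_gt0 // mulr_gt0.
have [tau [t01 sm]] := uniformly_smooth_norm US e'0; have /andP[t0 t1] := t01.
pose Q := 8 / (tau ^+ 2 * dl ^+ 2).
have Q0 : 0 < Q by rewrite divr_gt0 // mulr_gt0 // exprn_gt0.
exists (Num.min (Num.min (tau * dl / 4) (tau * `|x0 - y0| / 2)) (e / 2 / Q)).
  rewrite !lt_min; apply/andP; split; [apply/andP; split|].
  - by apply: divr_gt0 => //; exact: mulr_gt0.
  - by apply: divr_gt0 => //; exact: mulr_gt0.
  - by apply: divr_gt0 => //; exact: divr_gt0.
move=> y h hy; rewrite !lt_min => /andP[/andP[h1 h2] h3].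
have [Oy dy xy'] := nbr _ hy.
have [->|h0] := eqVneq h 0.
  by rewrite addr0 subr0 normr0 mulr0 mulr_natl mulr2n subrr.
apply: (le_trans (qh_second_difference domO Ox0 Oy h0 sm e'0 t01 dl0 dy _ _)).
- by move: h1; rewrite ltr_pdivlMr // mulrC => /ltW.
- apply: (le_trans (ltW h2)); rewrite -mulrA ler_pM2l //.
  have := ler_distD y x0 y0; rewrite [`|y - y0|]distrC; lra.
apply: ler_wpM2r => //.
have -> : 2 * (e * dl / 4) / dl = e / 2 by field; rewrite gt_eqF.
have : Q * `|h| <= e / 2 by rewrite mulrC -ler_pdivlMr // ltW.
rewrite -/Q; lra.
Qed.

Theorem theorem2p7 (R : realType) (X : completeNormedModType R)
    (Omega : set X) :
  uniformly_smooth X -> domain Omega -> convex_set Omega ->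
  forall x0 : X, Omega x0 ->
    continuously_differentiable_on (Omega `\ x0) (quasihyperbolic Omega x0).
Proof.
move=> US dO cO x0 Ox0; have domO := convex_domainP dO cO.
split=> x [Ox xx0]; have [df cv] := qh_C1_at domO Ox0 Ox xx0 US => //.
by apply: cvg_trans cv; apply: cvg_app; exact: cvg_within.
Qed.
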